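(* Let $0<\alpha\le 1$, $\gamma>0$, $t_c>0$, $\Delta\ge 0$ and $\zeta>\Delta$ (with $\zeta>0$), and let $\Phi$ be the predefined-time stabilizer defined in the context. Consider the time-variant quadratic programming problem $$\min_{x(t)}\ \tfrac12 x^{\mathrm T}(t)H(t)x(t)+\rho^{\mathrm T}(t)x(t)\quad\text{s.t. } A(t)x(t)=b(t),\ C(t)x(t)\le d(t),$$ or equivalently the time-variant quasi-linear equation $f(y(t),t)=0$ defined in the context, with theoretical solution $y^*(t)$, and put $y_0^*=y^*(0)$. Consider the noise-free fractional-order zeroing neural network $$M(t)\dot y(t)=-N(t)y(t)-\sigma(t)-\gamma t^{\alpha-1}\Phi(\epsilon(t)),\qquad \epsilon(t)=f(y(t),t),\qquad y(0)=y_0 .$$ Then, for initial conditions $y_0$ sufficiently close to $y_0^*$, the neural state $y(t)$ converges to the theoretical solution $y^*(t)$ in strictly predefined time $t_c$. That is, there is an open neighborhood $\Omega$ of $y_0^*$ such that for each $y_0\in\Omega\setminus\{y_0^*\}$ the trajectory starting at $y_0$ has a finite settling time $T(y_0)$ with $y(t)=y^*(t)$ for all $t\ge T(y_0)$, where $T$ is locally bounded, $T(y_0)\le t_c$, and $\sup_{y_0}T(y_0)=t_c$.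
   Context: **Problem data.** For $t\ge 0$: $H(t)\in\mathbb R^{n\times n}$ is positive semi-definite; $A(t)\in\mathbb R^{m\times n}$ and $C(t)\in\mathbb R^{p\times n}$ have full row rank; $\rho(t)\in\mathbb R^n$, $b(t)\in\mathbb R^m$, $d(t)\in\mathbb R^p$. All data are differentiable in $t$. The optimal solution of the quadratic program is assumed to be unique. **Quasi-linear equation.** Write $y(t)=[x^{\mathrm T}(t),\phi^{\mathrm T}(t),\varphi^{\mathrm T}(t)]^{\mathrm T}\in\mathbb R^{n+m+p}$ with $x\in\mathbb R^n$, $\phi\in\mathbb R^m$, $\varphi\in\mathbb R^p$ (the last two are Lagrange multipliers). Fix a small perturbation vector $\tau\in\mathbb R^p$ with positive entries ($\tau\to 0_+$), and set $$m(t)=d(t)-C(t)x(t),\qquad n(t)=\sqrt{m(t)\odot m(t)+\varphi(t)\odot\varphi(t)+\tau},$$ where $\odot$ is the entrywise product and the square root is entrywise. (The vector functions $m(t),n(t)$ are distinct from the dimensions $m,n$.) Then $f(y(t),t)=P(t)y(t)+q(t)$ with $$P=\begin{bmatrix} H & A^{\mathrm T} & C^{\mathrm T} \\ A & 0 & 0 \\ -C & 0 & I \end{bmatrix},\qquad q=\begin{bmatrix} \rho \\ -b \\ d-n \end{bmatrix}.$$ The equation $f(y(t),t)=0$ is the Karush-Kuhn-Tucker system of the quadratic program, with complementarity expressed by the perturbed Fischer-Burmeister function $\psi^\tau_{FB}(u,v)=u+v-\sqrt{u\odot u+v\odot v+\tau}$. The theoretical solution $y^*(t)$ satisfies $f(y^*(t),t)=0$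 for all $t$; its first $n$ entries give the solution of the quadratic program. **Coefficients of the network.** With $\Pi_1=\mathrm{diag}(m\oslash n)$ and $\Pi_2=\mathrm{diag}(\varphi\oslash n)$ ($\oslash$ is entrywise division), $$M=\begin{bmatrix} H & A^{\mathrm T} & C^{\mathrm T} \\ A & 0 & 0 \\ (\Pi_1-I)C & 0 & I-\Pi_2 \end{bmatrix},\quad N=\begin{bmatrix} \dot H & \dot A^{\mathrm T} & \dot C^{\mathrm T} \\ \dot A & 0 & 0 \\ (\Pi_1-I)\dot C & 0 & 0 \end{bmatrix},\quad \sigma=\begin{bmatrix} \dot\rho \\ -\dot b \\ (I-\Pi_1)\dot d \end{bmatrix}.$$ These are such that $\frac{d}{dt}f(y(t),t)=M\dot y+Ny+\sigma$, so the network is the expanded form of $t^{1-\alpha}\dot\epsilon(t)=-\gamma\Phi(\epsilon(t))$, whose left-hand side is the conformable fractional derivative of order $\alpha$ of $\epsilon$. **Activation function (predefined-time stabilizer).** With $\|\cdot\|$ the Euclidean norm and $$t_p=\Bigl(1-\exp\bigl(-\pi/(2\sqrt{\zeta(\zeta-\Delta)})\bigr)\Bigr)t_c,$$ the (time-dependent) function $\Phi$ is $$\Phi(x)=\begin{cases} \dfrac{1}{\gamma t_c^{\alpha-1}}\left(\dfrac{x}{t_c-t}+\dfrac{\gamma\|x\|^2}{(t_c-t)^2}\dfrac{x}{\|x\|}\right), & t<t_c, \\[3mm] \dfrac{1}{\gamma t^{\alpha-1}}\left(\dfrac{x}{t_p-t}+\Bigl(\zeta+\dfrac{\gamma t^{\alpha-1}\|x\|^2}{(t_p-t)^2}\Bigr)\dfrac{x}{\|x\|}\right),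 & t\ge t_c. \end{cases}$$ Here $\Delta$ is a constant which in the noise-perturbed version of the model bounds the magnitude of the noise; in the noise-free network it enters only through $t_p$ and the requirement $\zeta>\Delta$. **Strictly predefined-time convergence.** For a system $\dot z=\mathcal R(z,t)$ with equilibrium $0$: it is locally finite-time stable if there is an open neighborhood $\Omega$ of $0$ and a locally bounded settling-time function $T:\Omega\setminus\{0\}\to[0,\infty)$ such that each trajectory starting at $z_0\in\Omega\setminus\{0\}$ is at the origin for all $t\ge T(z_0)$; locally fixed-time stable if moreover $T$ is bounded on $\Omega$ by a constant; predefined-time stable with predefined constant $t_c>0$ if moreover $T(z_0)\le t_c$ for all $z_0\in\Omega$; and strictly predefined-time stable if moreover $\sup_{z_0\in\Omega}T(z_0)=t_c$. In the claim this is applied to the deviation $y-y^*$. *)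

(* Defs.v *)
From HB Require Import structures.
From mathcomp Require Import all_boot all_order all_algebra.
From mathcomp Require Import all_classical all_reals all_analysis.

Set Implicit Arguments.
Unset Strict Implicit.
Unset Printing Implicit Defensive.

Import Order.TTheory GRing.Theory Num.Theory.
Import numFieldNormedType.Exports.

Local Open Scope ring_scope.
Local Open Scope classical_set_scope.

(* A function on [0, +oo[ is represented by a total function on R whose values
   at negative arguments are irrelevant; hence the derivative at 0 is the
   right-hand one. *)
Definition differentiable_on_nonneg (R : realType) (V : normedModType R)
    (g : R -> V) : Prop :=
  (forall t : R, 0 < t -> derivable g t 1) /\
  cvg ((h^-1 *: (g h - g 0)) @[h --> (0 : R)^'+]).

(* The norm [`|x|] of the library on matrices is the sup norm. *)
Definition l2norm (R : realType) (k : nat) (x : 'cV[R]_k) : R :=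
  Num.sqrt (\sum_(i < k) x i 0 ^+ 2).

Definition psd (R : realType) (k : nat) (S : 'M[R]_k) : Prop :=
  S^T = S /\ forall v : 'cV[R]_k, 0 <= (v^T *m S *m v) 0 0.

Definition emul (R : realType) (k : nat) (u v : 'cV[R]_k) : 'cV[R]_k :=
  map2_mx *%R u v.

Definition ediv (R : realType) (k : nat) (u v : 'cV[R]_k) : 'cV[R]_k :=
  map2_mx (fun a b => a / b) u v.

Definition esqrt (R : realType) (k : nat) (u : 'cV[R]_k) : 'cV[R]_k :=
  map_mx Num.sqrt u.

(* minimize x^T H(t) x / 2 + rho(t)^T x
   subject to A(t) x = b(t) and C(t) x <= d(t). *)
Record tvqp (R : realType) (n m p : nat) := TVQP {
  qpH : R -> 'M[R]_n;
  qprho : R -> 'cV[R]_n;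
  qpA : R -> 'M[R]_(m, n);
  qpb : R -> 'cV[R]_m;
  qpC : R -> 'M[R]_(p, n);
  qpd : R -> 'cV[R]_p
}.

Section QuadraticProgram.
Variables (R : realType) (n m p : nat) (Q : tvqp R n m p).

Definition qp_cost (t : R) (x : 'cV[R]_n) : R :=
  2^-1 * (x^T *m qpH Q t *m x) 0 0 + ((qprho Q t)^T *m x) 0 0.

Definition qp_feasible (t : R) (x : 'cV[R]_n) : Prop :=
  qpA Q t *m x = qpb Q t /\
  forall i : 'I_p, (qpC Q t *m x) i 0 <= qpd Q t i 0.

Definition qp_optimal (t : R) (x : 'cV[R]_n) : Prop :=
  qp_feasible t x /\
  forall x' : 'cV[R]_n, qp_feasible t x' -> qp_cost t x <= qp_cost t x'.

Definition qp_differentiable : Prop :=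
  [/\ differentiable_on_nonneg (qpH Q), differentiable_on_nonneg (qprho Q),
      differentiable_on_nonneg (qpA Q) & differentiable_on_nonneg (qpb Q)] /\
  (differentiable_on_nonneg (qpC Q) /\ differentiable_on_nonneg (qpd Q)).

(* A state y : 'cV_(n + (m + p)) stacks the primal variable, the m multipliers
   of the equality constraints and the p multipliers of the inequality
   constraints. *)
Definition primal (y : 'cV[R]_(n + (m + p))) : 'cV[R]_n := usubmx y.
Definition eq_mult (y : 'cV[R]_(n + (m + p))) : 'cV[R]_m := usubmx (dsubmx y).
Definition ineq_mult (y : 'cV[R]_(n + (m + p))) : 'cV[R]_p := dsubmx (dsubmx y).

Variable tau : 'cV[R]_p.

Definition slack (y : 'cV[R]_(n + (m + p))) (t : R) : 'cV[R]_p :=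
  qpd Q t - qpC Q t *m primal y.

Definition fb_root (y : 'cV[R]_(n + (m + p))) (t : R) : 'cV[R]_p :=
  esqrt (emul (slack y t) (slack y t) +
         emul (ineq_mult y) (ineq_mult y) + tau).

Definition kktP (t : R) : 'M[R]_(n + (m + p)) :=
  block_mx (qpH Q t)               (row_mx (qpA Q t)^T (qpC Q t)^T)
           (col_mx (qpA Q t)
                   (- qpC Q t))    (block_mx 0 0
                                             0 1%:M).

Definition kktq (y : 'cV[R]_(n + (m + p))) (t : R) : 'cV[R]_(n + (m + p)) :=
  col_mx (qprho Q t) (col_mx (- qpb Q t) (qpd Q t - fb_root y t)).

Definition kktf (y : 'cV[R]_(n + (m + p))) (t : R) : 'cV[R]_(n + (m + p)) :=
  kktP t *m y + kktq y t.

Definition Pi1 (y : 'cV[R]_(n + (m + p))) (t : R) : 'M[R]_p :=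
  diag_mx (ediv (slack y t) (fb_root y t))^T.

Definition Pi2 (y : 'cV[R]_(n + (m + p))) (t : R) : 'M[R]_p :=
  diag_mx (ediv (ineq_mult y) (fb_root y t))^T.

Definition znnM (y : 'cV[R]_(n + (m + p))) (t : R) : 'M[R]_(n + (m + p)) :=
  block_mx (qpH Q t)                        (row_mx (qpA Q t)^T (qpC Q t)^T)
           (col_mx (qpA Q t)
                   ((Pi1 y t - 1%:M) *m qpC Q t))
                                            (block_mx 0 0
                                                      0 (1%:M - Pi2 y t)).

Definition znnN (y : 'cV[R]_(n + (m + p))) (t : R) : 'M[R]_(n + (m + p)) :=
  block_mx (derive1 (qpH Q) t)
           (row_mx (derive1 (qpA Q) t)^T (derive1 (qpC Q) t)^T)
           (col_mx (derive1 (qpA Q) t)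
                   ((Pi1 y t - 1%:M) *m derive1 (qpC Q) t))
           0.

Definition znnsigma (y : 'cV[R]_(n + (m + p))) (t : R) :
    'cV[R]_(n + (m + p)) :=
  col_mx (derive1 (qprho Q) t)
         (col_mx (- derive1 (qpb Q) t) ((1%:M - Pi1 y t) *m derive1 (qpd Q) t)).

(* The equation is imposed for t > 0, together with continuity at t = 0: for
   alpha < 1 the coefficient t^(alpha - 1) is singular at t = 0. *)
Definition znn_trajectory (alpha gamma : R)
    (Phi : R -> 'cV[R]_(n + (m + p)) -> 'cV[R]_(n + (m + p)))
    (y0 : 'cV[R]_(n + (m + p))) (y : R -> 'cV[R]_(n + (m + p))) : Prop :=
  [/\ y 0 = y0,
      y t @[t --> (0 : R)^'+] --> y 0 &
      forall t : R, 0 < t ->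
        derivable y t 1 /\
        znnM (y t) t *m derive1 y t =
          - (znnN (y t) t *m y t) - znnsigma (y t) t
          - (gamma * t `^ (alpha - 1)) *: Phi t (kktf (y t) t)].

End QuadraticProgram.

Definition stabilizer_tp (R : realType) (tc Delta zeta : R) : R :=
  (1 - expR (- (pi / (2 * Num.sqrt (zeta * (zeta - Delta)))))) * tc.

(* The direction x / ||x|| is read as 0 at x = 0, by 0^-1 = 0. *)
Definition stabilizer (R : realType) (k : nat) (alpha gamma tc Delta zeta : R)
    (t : R) (x : 'cV[R]_k) : 'cV[R]_k :=
  let u := (l2norm x)^-1 *: x in
  let tp := stabilizer_tp tc Delta zeta in
  if t < tc then
    (gamma * tc `^ (alpha - 1))^-1 *:
      ((tc - t)^-1 *: x + (gamma * l2norm x ^+ 2 / (tc - t) ^+ 2) *: u)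
  else
    (gamma * t `^ (alpha - 1))^-1 *:
      ((tp - t)^-1 *: x +
       (zeta + gamma * t `^ (alpha - 1) * l2norm x ^+ 2 / (tp - t) ^+ 2) *: u).

(* The settling time is the least time from which y agrees with ystar; without
   minimality, the supremum in [strictly_predefined_time_convergent] would be
   attained by a constant function, whatever the trajectories. *)
Definition is_settling_time (R : realType) (V : normedModType R)
    (y ystar : R -> V) (T : R) : Prop :=
  [/\ 0 <= T,
      forall t : R, T <= t -> y t = ystar t &
      forall s : R, 0 <= s -> (forall t : R, s <= t -> y t = ystar t) ->
        T <= s].

(* [traj z y] reads: y is a trajectory starting at z. *)
Definition strictly_predefined_time_convergent (R : realType)
    (V : normedModType R) (traj : V -> (R -> V) -> Prop) (ystar : R -> V)
    (tc : R) : Prop :=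
  exists (Omega : set V) (T : V -> R),
    let D := Omega `\ ystar 0 in
    [/\ open Omega /\ Omega (ystar 0),
        forall y0 : V, D y0 ->
          (exists y : R -> V, traj y0 y) /\
          (forall y : R -> V, traj y0 y -> is_settling_time y ystar (T y0)),
        [locally [bounded T y0 | y0 in D]],
        forall y0 : V, D y0 -> T y0 <= tc &
        sup [set T y0 | y0 in D] = tc].

(* Main.v *)
Require Import Defs.
From HB Require Import structures.
From mathcomp Require Import all_boot all_order all_algebra.
From mathcomp Require Import all_classical all_reals all_analysis.
From mathcomp Require Import ring lra.
Set Implicit Arguments.
Unset Strict Implicit.
Unset Printing Implicit Defensive.
Import Order.TTheory GRing.Theory Num.Theory.
Import numFieldNormedType.Exports.
Local Open Scope ring_scope.
Local Open Scope classical_set_scope.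

(* Along a trajectory the residual e(t) = f(y(t), t) satisfies
   e' = - gamma t^(alpha-1) Phi(e), an equation that preserves the direction
   of e.  For t < tc its norm r satisfies
     r' = - (t/tc)^(alpha-1) (r / (tc - t) + gamma r^2 / (tc - t)^2),
   so that r stays positive on [0, tc[ and vanishes at tc; the second branch of
   Phi keeps it at 0 from then on.  Since f(., t) is injective, y meets ystar
   exactly from tc on: every trajectory has settling time tc.
   Injectivity comes from the exact mean value identity
   f(y, t) - f(y', t) = J(y, y', t) (y - y'), where J has the shape of the
   network matrix M with the entries of Pi1 and Pi2 averaged over y and y'.
   Such a J is invertible because these entries are < 1, A has full row rank,
   and H, A, C have no common kernel, the optimum being unique.
   A trajectory is obtained by first solving the scalar equation for r and then
   f(y(t), t) = (r(t) / r(0)) f(y0, 0) for y(t): the squared distance of f(., t)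
   to a target close to 0 has a minimum in the interior of a small ball, where
   the invertibility of J makes it vanish; y is continuous by injectivity and
   differentiable by the mean value identity. *)

(** * Limits and derivatives of matrix-valued functions *)

Lemma cvg_sumr (R : numFieldType) (T I : Type) (F : set_system T)
    (FF : Filter F) (r : seq I) (P : pred I) (f : I -> T -> R) (l : I -> R) :
  (forall i, P i -> f i x @[x --> F] --> l i) ->
  \sum_(i <- r | P i) f i x @[x --> F] --> \sum_(i <- r | P i) l i.
Proof. by move=> fl; apply: cvg_big => //; exact: add_continuous. Qed.

Lemma cvg_prodr (R : numFieldType) (T I : Type) (F : set_system T)
    (FF : Filter F) (r : seq I) (P : pred I) (f : I -> T -> R) (l : I -> R) :
  (forall i, P i -> f i x @[x --> F] --> l i) ->
  \prod_(i <- r | P i) f i x @[x --> F] --> \prod_(i <- r | P i) l i.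
Proof. by move=> fl; apply: cvg_big => //; exact: mul_continuous. Qed.

Lemma cvg_mxP (R : realFieldType) (T : Type) (F : set_system T)
    (FF : Filter F) (m n : nat) (f : T -> 'M[R]_(m, n)) (l : 'M[R]_(m, n)) :
  f x @[x --> F] --> l <-> forall i j, f x i j @[x --> F] --> l i j.
Proof.
split=> [fl i j|fl].
  by apply: (@continuous_cvg _ _ _ F FF f (fun M : 'M[R]_(m, n) => M i j)) => //;
    exact: coord_continuous.
apply/cvgrPdist_le => /= e e0; near=> x.
rewrite /Num.Def.normr/= mx_normrE (bigmax_le _ (ltW e0))//= => i _.
rewrite !mxE/=; move: i; near: x; apply: filter_forall => /= i.
exact: ((cvgrPdist_le _ _).1 (fl i.1 i.2)).
Unshelve. all: by end_near. Qed.

Lemma cvg_mulmx (R : realFieldType) (T : Type) (F : set_system T)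
    (FF : Filter F) (m n k : nat) (f : T -> 'M[R]_(m, n))
    (g : T -> 'M[R]_(n, k)) (a : 'M[R]_(m, n)) (b : 'M[R]_(n, k)) :
  f x @[x --> F] --> a -> g x @[x --> F] --> b ->
  f x *m g x @[x --> F] --> a *m b.
Proof.
move=> /cvg_mxP fa /cvg_mxP gb; apply/cvg_mxP => i j.
rewrite mxE; under eq_cvg do rewrite mxE.
by apply: cvg_sumr => s _; exact: cvgM.
Qed.

Lemma cvg_trmx (R : realFieldType) (T : Type) (F : set_system T)
    (FF : Filter F) (m n : nat) (f : T -> 'M[R]_(m, n)) (a : 'M[R]_(m, n)) :
  f x @[x --> F] --> a -> (f x)^T @[x --> F] --> a^T.
Proof.
move=> /cvg_mxP fa; apply/cvg_mxP => i j.
by rewrite mxE; under eq_cvg do rewrite mxE; exact: fa.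
Qed.

Lemma cvg_usubmx (R : realFieldType) (T : Type) (F : set_system T)
    (FF : Filter F) (m1 m2 n : nat) (f : T -> 'M[R]_(m1 + m2, n))
    (a : 'M[R]_(m1 + m2, n)) :
  f x @[x --> F] --> a -> usubmx (f x) @[x --> F] --> usubmx a.
Proof.
move=> /cvg_mxP fa; apply/cvg_mxP => i j.
by rewrite mxE; under eq_cvg do rewrite mxE; exact: fa.
Qed.

Lemma cvg_dsubmx (R : realFieldType) (T : Type) (F : set_system T)
    (FF : Filter F) (m1 m2 n : nat) (f : T -> 'M[R]_(m1 + m2, n))
    (a : 'M[R]_(m1 + m2, n)) :
  f x @[x --> F] --> a -> dsubmx (f x) @[x --> F] --> dsubmx a.
Proof.
move=> /cvg_mxP fa; apply/cvg_mxP => i j.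
by rewrite mxE; under eq_cvg do rewrite mxE; exact: fa.
Qed.

Lemma cvg_col_mx (R : realFieldType) (T : Type) (F : set_system T)
    (FF : Filter F) (m1 m2 n : nat) (f : T -> 'M[R]_(m1, n))
    (g : T -> 'M[R]_(m2, n)) (a : 'M[R]_(m1, n)) (b : 'M[R]_(m2, n)) :
  f x @[x --> F] --> a -> g x @[x --> F] --> b ->
  col_mx (f x) (g x) @[x --> F] --> col_mx a b.
Proof.
move=> /cvg_mxP fa /cvg_mxP gb; apply/cvg_mxP => i j.
rewrite mxE; under eq_cvg do rewrite mxE.
by case: split_ordP => k _; [exact: fa | exact: gb].
Qed.

Lemma cvg_row_mx (R : realFieldType) (T : Type) (F : set_system T)
    (FF : Filter F) (m n1 n2 : nat) (f : T -> 'M[R]_(m, n1))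
    (g : T -> 'M[R]_(m, n2)) (a : 'M[R]_(m, n1)) (b : 'M[R]_(m, n2)) :
  f x @[x --> F] --> a -> g x @[x --> F] --> b ->
  row_mx (f x) (g x) @[x --> F] --> row_mx a b.
Proof.
move=> /cvg_mxP fa /cvg_mxP gb; apply/cvg_mxP => i j.
rewrite mxE; under eq_cvg do rewrite mxE.
by case: split_ordP => k _; [exact: fa | exact: gb].
Qed.

Lemma cvg_det (R : realFieldType) (T : Type) (F : set_system T)
    (FF : Filter F) (n : nat) (f : T -> 'M[R]_n) (a : 'M[R]_n) :
  f x @[x --> F] --> a -> \det (f x) @[x --> F] --> \det a.
Proof.
move=> /cvg_mxP fa; apply: cvg_sumr => s _.
by apply: cvgM; [exact: cvg_cst | exact: cvg_prodr].
Qed.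

Lemma cvg_invmx (R : realFieldType) (T : Type) (F : set_system T)
    (FF : Filter F) (n : nat) (f : T -> 'M[R]_n) (a : 'M[R]_n) :
  (forall x, f x \in unitmx) -> a \in unitmx ->
  f x @[x --> F] --> a -> invmx (f x) @[x --> F] --> invmx a.
Proof.
(* Invertibility selects the cofactor formula on both sides; its entries are polynomials in the
   entries of the matrix, divided by a determinant with nonzero limit. *)
move=> fu au fa; rewrite /invmx au; under eq_cvg do rewrite fu.
apply/cvg_mxP => i j; rewrite !mxE; under eq_cvg do rewrite !mxE.
apply: cvgM.
  by apply: cvgV; [rewrite -unitfE -unitmxE | exact: cvg_det].
apply: cvgM; first exact: cvg_cst.
apply: cvg_det; apply/cvg_mxP => k l; rewrite !mxE.
under eq_cvg do rewrite !mxE.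
by move/cvg_mxP : fa; exact.
Qed.

Lemma is_derive_mxP (R : realFieldType) (m n : nat) (f : R -> 'M[R]_(m, n))
    (t : R) (df : 'M[R]_(m, n)) :
  is_derive t 1 f df <->
  forall i j, is_derive t 1 (fun s => f s i j) (df i j).
Proof.
split=> [[dft <-] i j|dfij].
  by split; [exact: (derivable_mxP _ _ _).1 | rewrite derive_mx// mxE].
have dft : derivable f t 1 by apply/derivable_mxP => i j; case: (dfij i j).
split=> //; rewrite derive_mx//; apply/matrixP => i j; rewrite mxE.
by case: (dfij i j).
Qed.

Lemma is_derive_mulmx (R : realFieldType) (m n k : nat)
    (f : R -> 'M[R]_(m, n)) (g : R -> 'M[R]_(n, k)) (t : R)
    (df : 'M[R]_(m, n)) (dg : 'M[R]_(n, k)) :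
  is_derive t 1 f df -> is_derive t 1 g dg ->
  is_derive t 1 (fun s => f s *m g s) (df *m g t + f t *m dg).
Proof.
move=> /is_derive_mxP fa /is_derive_mxP gb; apply/is_derive_mxP => i j.
have d : is_derive t 1 (\sum_(l < n) ((fun s => f s i l) * (fun s => g s l j)))
    (\sum_(l < n) (f t i l *: dg l j + g t l j *: df i l)).
  by apply: is_derive_sum => l; apply: is_deriveM.
rewrite (_ : (fun s => _) =
    \sum_(l < n) ((fun s => f s i l) * (fun s => g s l j))); last first.
  by apply/funext => s; rewrite mxE fct_sumE.
apply: is_derive_eq.
rewrite !mxE -big_split/=; apply: eq_bigr => l _.
by rewrite addrC; congr (_ + _); exact: mulrC.
Qed.

Lemma is_derive_trmx (R : realFieldType) (m n : nat)
    (f : R -> 'M[R]_(m, n)) (t : R) (df : 'M[R]_(m, n)) :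
  is_derive t 1 f df -> is_derive t 1 (fun s => (f s)^T) df^T.
Proof.
move=> /is_derive_mxP fa; apply/is_derive_mxP => i j.
by rewrite mxE; under eq_fun do rewrite mxE.
Qed.

Lemma is_derive_usubmx (R : realFieldType) (m1 m2 n : nat)
    (f : R -> 'M[R]_(m1 + m2, n)) (t : R) (df : 'M[R]_(m1 + m2, n)) :
  is_derive t 1 f df -> is_derive t 1 (fun s => usubmx (f s)) (usubmx df).
Proof.
move=> /is_derive_mxP fa; apply/is_derive_mxP => i j.
by rewrite mxE; under eq_fun do rewrite mxE.
Qed.

Lemma is_derive_dsubmx (R : realFieldType) (m1 m2 n : nat)
    (f : R -> 'M[R]_(m1 + m2, n)) (t : R) (df : 'M[R]_(m1 + m2, n)) :
  is_derive t 1 f df -> is_derive t 1 (fun s => dsubmx (f s)) (dsubmx df).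
Proof.
move=> /is_derive_mxP fa; apply/is_derive_mxP => i j.
by rewrite mxE; under eq_fun do rewrite mxE.
Qed.

Lemma is_derive_col_mx (R : realFieldType) (m1 m2 n : nat)
    (f : R -> 'M[R]_(m1, n)) (g : R -> 'M[R]_(m2, n)) (t : R)
    (df : 'M[R]_(m1, n)) (dg : 'M[R]_(m2, n)) :
  is_derive t 1 f df -> is_derive t 1 g dg ->
  is_derive t 1 (fun s => col_mx (f s) (g s)) (col_mx df dg).
Proof.
move=> /is_derive_mxP fa /is_derive_mxP gb; apply/is_derive_mxP => i j.
rewrite mxE; under eq_fun do rewrite mxE.
by case: split_ordP => k _.
Qed.

(** Heine-Borel for row vectors, carried to columns by transposition, an isometry for the sup
    norm. *)
Lemma compact_mx_ball (R : realType) (n : nat) (a : 'cV[R]_n) (r : R) :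
  compact [set y | `|y - a| <= r].
Proof.
have Tn (x : 'rV[R]_n) : `|x^T| = `|x|.
  rewrite /Num.Def.normr/= !mx_normrE; apply/le_anti/andP; split.
    apply: bigmax_le => [|[i j] _] /=; first exact: bigmax_ge_id.
    by rewrite mxE; exact: (le_bigmax _ (fun k => `|x k.1 k.2|) (j, i)).
  apply: bigmax_le => [|[i j] _] /=; first exact: bigmax_ge_id.
  apply: le_trans (le_bigmax _ (fun k => `|x^T k.1 k.2|) (j, i)).
  by rewrite /= mxE.
have -> : [set y | `|y - a| <= r] =
    trmx @` [set z : 'rV[R]_n | `|z - a^T| <= r].
  apply/seteqP; split=> [y /= yr|_ /= [z zr <-]].
    by exists y^T; rewrite ?trmxK//= -linearB/= -Tn trmxK.
  by rewrite -[a]trmxK -linearB/= Tn.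
apply: continuous_compact.
  apply: continuous_subspaceT => z; 
  exact: (@cvg_trmx _ _ (nbhs z) _ _ _ id z cvg_id).
apply: bounded_closed_compact; last first.
  rewrite (_ : [set z | _] = (fun z => `|z - a^T|) @^-1` [set x | x <= r])//.
  apply: closed_comp; last exact: closed_le.
  move=> z _; 
  apply: (@cvg_norm _ _ _ (nbhs z)).
  exact: (cvgB cvg_id (cvg_cst _)).
exists (r + `|a^T|); split; first exact: num_real.
move=> M rM z /= zr; apply: le_trans (ltW rM).
by rewrite -[z](subrK a^T) (le_trans (ler_normD _ _))// lerD2r.
Qed.

(** * A scalar equation with a singular weight *)

Lemma is_derive_add (R : realFieldType) (V : normedModType R) (f g : R -> V)
    (t : R) (df dg : V) :
  is_derive t 1 f df -> is_derive t 1 g dg ->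
  is_derive t 1 (fun s => f s + g s) (df + dg).
Proof. by move=> fd gd; exact: is_deriveD. Qed.

Lemma is_derive_sub (R : realFieldType) (V : normedModType R) (f g : R -> V)
    (t : R) (df dg : V) :
  is_derive t 1 f df -> is_derive t 1 g dg ->
  is_derive t 1 (fun s => f s - g s) (df - dg).
Proof. by move=> fd gd; exact: is_deriveB. Qed.

Lemma is_derive_mulr (R : realFieldType) (f g : R -> R) (t df dg : R) :
  is_derive t 1 f df -> is_derive t 1 g dg ->
  is_derive t 1 (fun s => f s * g s) (df * g t + f t * dg).
Proof.
move=> fd gd.
have d : is_derive t 1 (f * g) (f t *: dg + g t *: df) by exact: is_deriveM.
apply: (is_derive_eq d).
by rewrite addrC; congr (_ + _); exact: mulrC.
Qed.

Lemma is_derive_continuous (R : realFieldType) (V : normedModType R)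
    (f : R -> V) (t : R) (df : V) :
  is_derive t 1 f df -> {for t, continuous f}.
Proof.
by move=> [/derivable1_diffP dft _]; exact: differentiable_continuous.
Qed.

(** The mean value theorem. At [a] only right continuity is asked, because the equations below hold
    for [t > 0] and their weight may be singular at 0. *)
Lemma is_derive_ge0_le (R : realType) (f df : R -> R) (a b : R) : a <= b ->
  f x @[x --> a^'+] --> f a ->
  (forall t, a < t <= b -> is_derive t 1 f (df t)) ->
  (forall t, a < t <= b -> 0 <= df t) -> f a <= f b.
Proof.
rewrite le_eqVlt => /predU1P[-> //|ab] fa fd df0.
have [|| c cab e] := @MVT R f df a b ab.
- by move=> x /[!in_itv]/= /andP[ax xb]; apply: fd; rewrite ax ltW.
- apply/continuous_within_itvP => //; split => //.
    move=> x xab; have /andP[ax xb] : a < x < b.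
      by move: xab; rewrite ?inE/= ?in_itv.
    by apply: (@is_derive_continuous _ _ _ _ (df x)); apply: fd; rewrite ax ltW.
  apply: cvg_at_left_filter.
  by apply: (@is_derive_continuous _ _ _ _ (df b)); apply: fd; rewrite ab lexx.
rewrite -subr_ge0 e mulr_ge0// ?subr_ge0 ?(ltW ab)//.
by apply: df0; move: cab; rewrite in_itv/= => /andP[-> /ltW].
Qed.

(** Freezing a function to the left of 0 turns right continuity at 0 into continuity, so that
    results stated with full neighborhoods apply. *)
Lemma continuous_max0 (R : realType) (V : normedModType R) (F : R -> V)
    (t : R) :
  F x @[x --> (0 : R)^'+] --> F 0 -> (0 < t -> {for t, continuous F}) ->
  {for t, continuous (fun s : R => F (Num.max s 0))}.
Proof.
move=> F0 Ft; have [t0|t0|t0] := ltgtP t 0.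
- apply: (@near_cst_continuous _ _ (F 0)).
  near=> s; rewrite max_r// ltW//; near: s; exact: lt_nbhsl.
- rewrite /prop_for /continuous_at max_l ?(ltW t0)//.
  apply: (cvg_trans _ (Ft t0)).
  apply: (@near_eq_cvg R V (nbhs t)); near=> s; rewrite max_l// ltW//.
  by near: s; exact: lt_nbhsr.
- rewrite t0 /prop_for /continuous_at maxxx; apply/cvgrPdist_le => e e0.
  move/cvgrPdist_le : F0 => /(_ e e0); rewrite near_withinE => H.
  near=> s; have [s0|s0] := leP s 0; first by rewrite subrr normr0 ltW.
  have : 0 < s -> `|F 0 - F s| <= e by near: s; exact: H.
  exact.
Unshelve. all: by end_near. Qed.

Lemma powR_max0_continuous (R : realType) (p : R) : 0 < p ->
  continuous (fun s : R => Num.max s 0 `^ p).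
Proof.
move=> p0 t; apply: (@continuous_max0 _ _ (fun x : R => x `^ p)).
  by rewrite powR0 ?gt_eqF//; exact: powR_cvg0.
by move=> t0; exact: is_derive_continuous (is_derive1_powR p t0).
Qed.

(* The substitution [s = t `^ alpha] removes the singularity of the weight. *)
Lemma weighted_primitive (R : realType) (alpha tc : R) (h : R -> R) :
  0 < alpha -> 0 < tc -> (forall t, t < tc -> {for t, continuous h}) ->
  exists F : R -> R, [/\ F 0 = 0, F x @[x --> 0^'+] --> F 0 &
    forall t, 0 < t < tc -> is_derive t 1 F (t `^ (alpha - 1) * h t)].
Proof.
move=> a0 tc0 hc.
have ai0 : 0 < alpha^-1 by rewrite invr_gt0.
have tca0 : 0 < tc `^ alpha by rewrite powR_gt0.
have powK (x : R) : 0 <= x -> (x `^ alpha) `^ alpha^-1 = x.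
  by move=> x0; rewrite -powRrM divff ?gt_eqF// powRr1.
pose root (s : R) := Num.max s 0 `^ alpha^-1.
have rootlt s : s < tc `^ alpha -> root s < tc.
  move=> stc; rewrite -(powK tc) ?ltW//.
  apply: gt0_ltr_powR => //; rewrite ?nnegrE ?le_max ?lexx ?orbT// ?ltW//.
  by rewrite gt_max stc.
pose g s := alpha^-1 * h (root s).
have gc s : s < tc `^ alpha -> {for s, continuous g}.
  move=> stc; apply: cvgM; first exact: cvg_cst.
  apply: (@continuous_comp _ _ _ root h); first exact: powR_max0_continuous.
  by apply: hc; exact: rootlt.
(* Integrating from [-1] makes 0 an interior point, whence the continuity of [G] at 0; [root] is
   frozen at 0 for negative arguments. *)
pose G x := (\int[@lebesgue_measure R]_(t in [set` `[-1, x]]) g t)%R.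
have Gd x : -1 < x < tc `^ alpha -> is_derive x 1 G (g x).
  move=> /andP[x1 xtc]; have xu := midf_lt xtc.
  have gi : (@lebesgue_measure R).-integrable `[-1, ((x + tc `^ alpha) / 2)]
      (EFin \o g).
    apply: continuous_compact_integrable; first exact: segment_compact.
    apply: continuous_in_subspaceT => z /[!inE]/= /[!in_itv]/= /andP[_ zu].
    by apply: gc; apply: le_lt_trans zu _; lra.
  have [dG eG] := @continuous_FTC1_closed R g (-1) x _ xu.1 gi x1 (gc _ xtc).
  apply: DeriveDef; first exact: dG.
  by rewrite -derive1E; exact: eG.
exists (fun t => G (t `^ alpha) - G 0); split.
- by rewrite powR0 ?gt_eqF// subrr.
- apply: cvgB; last exact: cvg_cst.
  rewrite powR0 ?gt_eqF//.
  apply: (@cvg_comp _ _ _ (fun x : R => x `^ alpha) G _ (nbhs 0)).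
    exact: powR_cvg0.
  apply: (@is_derive_continuous _ _ _ _ (g 0)); apply: Gd.
  by rewrite tca0 andbT; lra.
- move=> t /andP[t0 ttc].
  have ta0 : 0 < t `^ alpha by rewrite powR_gt0.
  have Gt : is_derive (t `^ alpha) 1 G (g (t `^ alpha)).
    apply: Gd; rewrite (lt_trans _ ta0)/= ?ltrN10//.
    by apply: gt0_ltr_powR; rewrite ?nnegrE ?ltW.
  have d := @is_derive1_comp R G (fun x => x `^ alpha) t _ _ Gt
    (is_derive1_powR alpha t0).
  rewrite -[X in is_derive _ _ _ X]subr0; apply: is_derive_sub.
  apply: (is_derive_eq d).
  rewrite /g /root max_l ?ltW// powK ?ltW//.
  by field; rewrite gt_eqF.
Qed.

(** The exponent [alpha - 1] is nonpositive, so the power decreases towards its value at [tc]. This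
    bound makes the decay at least as fast as for [alpha = 1]. *)
Lemma ge1_time_weight (R : realType) (alpha tc t : R) : alpha <= 1 ->
  0 < t <= tc -> 1 <= (tc `^ (alpha - 1))^-1 * t `^ (alpha - 1).
Proof.
move=> a1 /andP[t0 ttc].
have tc0 := lt_le_trans t0 ttc.
rewrite -[alpha - 1]opprB !powRN invrK ler_pdivlMr ?powR_gt0// mul1r.
by apply: ge0_ler_powR; rewrite ?nnegrE ?subr_ge0// ltW.
Qed.

(* The reciprocal [w] of a solution solves a linear equation, which is
   integrated by variation of constants. *)
Lemma norm_equation_solution (R : realType) (alpha gamma tc r0 : R) :
  0 < alpha <= 1 -> 0 < gamma -> 0 < tc -> 0 < r0 ->
  exists r : R -> R,
    [/\ r 0 = r0, r x @[x --> 0^'+] --> r0,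
        forall t, 0 <= t < tc -> 0 < r t <= r0,
        forall t, tc <= t -> r t = 0 /\ is_derive t 1 r 0 &
        forall t, 0 < t < tc -> is_derive t 1 r
          (- (tc `^ (alpha - 1))^-1 * t `^ (alpha - 1) *
             (r t / (tc - t) + gamma * r t ^+ 2 / (tc - t) ^+ 2))].
Proof.
move=> /andP[a0 a1] g0 tc0 r00.
pose c := (tc `^ (alpha - 1))^-1.
have c0 : 0 < c by rewrite invr_gt0 powR_gt0.
have subc (t : R) : {for t, continuous (fun s : R => tc - s)}.
  by apply: cvgB; [exact: cvg_cst|exact: cvg_id].
have invc (t : R) : t < tc -> {for t, continuous (fun s : R => (tc - s)^-1)}.
  by move=> ttc; apply: cvgV; [rewrite subr_eq0 gt_eqF|exact: subc].
(* [K] is the exponent of the integrating factor for [w' = k (w / (tc - t) + gamma / (tc - t)^2)],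
   with [k] as defined below. *)
have [|K [K0 Kc Kd]] := @weighted_primitive R alpha tc
    (fun t => c * (tc - t)^-1) a0 tc0.
  by move=> t ttc; apply: cvgM; [exact: cvg_cst|exact: invc].
(* [J] integrates the inhomogeneous term multiplied by [expR (- K t)]. *)
have [|J [J0 Jc Jd]] := @weighted_primitive R alpha tc
    (fun t => c * gamma * expR (- K (Num.max t 0)) * ((tc - t)^-1 * (tc - t)^-1))
    a0 tc0.
  move=> t ttc; apply: cvgM; last by apply: cvgM; exact: invc.
  apply: cvgM; first exact: cvg_cst.
  apply: (@continuous_cvg _ _ _ (nbhs t) _ (fun t : R => - K (Num.max t 0)) expR).
    exact: (@continuous_expR R).
    apply: cvgN; apply: continuous_max0 => // t0.
    by apply: is_derive_continuous (Kd t _); rewrite t0.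
have KJ0 t : 0 <= t < tc -> 0 <= K t /\ 0 <= J t.
  move=> /andP[t0 ttc]; rewrite -[X in X <= K t]K0 -[X in X <= J t]J0; split.
    apply: (is_derive_ge0_le t0 Kc) => s /andP[s0 st].
      by apply: Kd; rewrite s0 (le_lt_trans st).
    by rewrite !mulr_ge0 ?powR_ge0 ?(ltW c0)// invr_ge0 subr_ge0 ltW//
      (le_lt_trans st).
  apply: (is_derive_ge0_le t0 Jc) => s /andP[s0 st].
    by apply: Jd; rewrite s0 (le_lt_trans st).
  by rewrite !mulr_ge0 ?powR_ge0 ?expR_ge0 ?(ltW c0) ?(ltW g0)// invr_ge0
    subr_ge0 ltW// (le_lt_trans st).
pose w t := expR (K t) * (r0^-1 + J t).
have wge t : 0 <= t < tc -> r0^-1 <= w t.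
  move=> /KJ0 [Kt Jt]; rewrite -[leLHS]mul1r.
  apply: ler_pM; rewrite ?invr_ge0 ?(ltW r00)//.
    by rewrite -expR0 ler_expR.
  by rewrite lerDl.
have w_gt0 t : 0 <= t < tc -> 0 < w t.
  by move=> /wge; apply: lt_le_trans; rewrite invr_gt0.
pose k (t : R) := c * t `^ (alpha - 1).
have wd t : 0 < t < tc -> is_derive t 1 w
    (k t * (w t / (tc - t) + gamma / (tc - t) ^+ 2)).
  move=> tI; have [t0 ttc] := andP tI.
  have dE := is_derive1_comp (is_derive_expR (K t)) (Kd t tI).
  have dJ := is_derive_add (is_derive_cst r0^-1 t 1) (Jd t tI).
  apply: (is_derive_eq (is_derive_mulr dE dJ)).
  rewrite /= max_l ?ltW// expRN /w /k.
  by field; rewrite subr_eq0 !gt_eqF ?expR_gt0.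
pose r t := if t < tc then (w t)^-1 else 0.
have rw t : t < tc -> r t = (w t)^-1 by rewrite /r => ->.
exists r; split.
- by rewrite rw// /w K0 J0 expR0 mul1r addr0 invrK.
- have -> : r0 = (w 0)^-1 by rewrite /w K0 J0 expR0 mul1r addr0 invrK.
  apply: cvg_trans.
    apply: (@near_eq_cvg _ _ _ _ (fun x => (w x)^-1)); near=> x.
    by rewrite rw//; near: x; exact: nbhs_right_lt.
  apply: cvgV; first by rewrite gt_eqF// w_gt0// lexx.
  apply: cvgM; last by apply: cvgD => //; exact: cvg_cst.
  by apply: (@continuous_cvg _ _ _ _ _ K expR) => //; exact: (@continuous_expR R).
- move=> t tI; have [t0 ttc] := andP tI; rewrite rw// invr_gt0 w_gt0//=.
  by rewrite -[leRHS]invrK lef_pV2 ?posrE ?invr_gt0 ?w_gt0 ?wge.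
- move=> t; rewrite le_eqVlt => /predU1P[<-|tct]; last first.
    split; first by rewrite /r ltNge ltW.
    apply: (near_eq_is_derive _ (is_derive_cst (0 : R) t 1)).
    by near=> s; rewrite /r ltNge ltW//=; near: s; exact: lt_nbhsr.
  split; first by rewrite /r ltxx.
  (* Since [k >= 1], [D] is nondecreasing on [[tc / 2, tc[]. Hence [w t * (tc - t)] is at least
     [D (tc / 2) - gamma * ln (tc - t)], which tends to infinity: [r t] is negligible before
     [tc - t], and [r] has derivative 0 at [tc]. *)
  pose D t := w t * (tc - t) + gamma * ln (tc - t).
  have Dd s : 0 < s < tc -> is_derive s 1 D
      ((k s - 1) * (w s + gamma / (tc - s))).
    move=> sI; have [s0 stc] := andP sI.
    have ds : is_derive s 1 (fun z : R => tc - z) (0 - 1).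
      exact: is_derive_sub (is_derive_cst _ _ _) (is_derive_id _ _).
    have tcs : 0 < tc - s by rewrite subr_gt0.
    have dl := @is_derive1_comp R (@ln R) (fun z => tc - z) s _ _
      (is_derive1_ln tcs) ds.
    have d := is_derive_add (is_derive_mulr (wd s sI) ds)
      (is_derive_mulr (is_derive_cst gamma s 1) dl).
    apply: (is_derive_eq d) => /=.
    by field; rewrite gt_eqF.
  have Dge u : tc / 2 <= u < tc -> D (tc / 2) <= D u.
    move=> /andP[u2 utc].
    have dD s : tc / 2 <= s <= u -> is_derive s 1 D
      ((k s - 1) * (w s + gamma / (tc - s))).
      by move=> /andP[s1 s2]; apply: Dd; apply/andP; split; lra.
    apply: (is_derive_ge0_le u2).
    - apply: cvg_at_right_filter.
      by apply: (is_derive_continuous (dD _ _)); rewrite lexx u2.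
    - by move=> s /andP[s1 s2]; apply: dD; rewrite ltW.
    - move=> s /andP[s1 s2].
      have sI : 0 <= s < tc by apply/andP; split; lra.
      apply: mulr_ge0.
        by rewrite subr_ge0; apply: ge1_time_weight => //; apply/andP; split; lra.
      rewrite addr_ge0 ?(ltW (w_gt0 _ sI))// divr_ge0 ?(ltW g0)//.
      by move/andP : sI => [_ /ltW]; rewrite subr_ge0.
  apply/is_derive1_caratheodory.
  exists (fun z => if z < tc then - (w z * (tc - z))^-1 else 0); split.
  + move=> z; rewrite /r ltxx subr0; case: ifPn => [ztc|]; last by rewrite mul0r.
    (* For negative [z] the sign of [w z] is unknown; if it vanishes, both sides are 0 by
       [0^-1 = 0]. *)
    have [wz|wz] := eqVneq (w z) 0; first by rewrite wz mul0r !invr0 oppr0 mul0r.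
    by field; rewrite wz subr_eq0 gt_eqF.
  + rewrite /prop_for /continuous_at ltxx; apply/cvgrPdist_le => e e0.
    near=> z; rewrite sub0r normrN; case: ifPn => [ztc|_]; last first.
      by rewrite normr0 ltW.
    have z2 : tc / 2 <= z.
      by apply/ltW; near: z; apply: lt_nbhsr; lra.
    have zI : 0 <= z < tc by rewrite ztc andbT; lra.
    have wz := w_gt0 _ zI.
    have tcz : 0 < tc - z by rewrite subr_gt0.
    rewrite normrN ger0_norm; last by rewrite invr_ge0 ltW// mulr_gt0.
    rewrite -[leRHS]invrK lef_pV2 ?posrE ?invr_gt0//; last first.
      by apply: mulr_gt0.
    have := Dge z; rewrite z2 ztc => /(_ isT); rewrite {2}/D => H.
    (* This closeness to [tc] makes the lower bound on [w z * (tc - z)] at least [e^-1], so the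
       slope is at most [e] in absolute value. *)
    have : ln (tc - z) <= (D (tc / 2) - e^-1) / gamma.
      rewrite -ler_expR lnK ?posrE// lerBlDl -lerBlDr.
      apply/ltW; near: z; apply: lt_nbhsr.
      by rewrite ltrBlDr ltrDl expR_gt0.
    by rewrite ler_pdivlMr// => H2; lra.
  + by rewrite ltxx.
- move=> t tI; have [t0 ttc] := andP tI.
  have wt : w t != 0 by rewrite gt_eqF// w_gt0// ltW.
  have nr : \forall s \near t, (w s)^-1 = r s.
    by near=> s; rewrite rw//; near: s; exact: lt_nbhsl.
  apply: (is_derive_eq (near_eq_is_derive nr (is_deriveV wt (wd t tI)))).
  rewrite rw// /k /GRing.scale/= -/c.
  by field; rewrite wt subr_eq0 gt_eqF.
Unshelve. all: by end_near. Qed.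

(** * Algebra of the Karush-Kuhn-Tucker map *)

Definition coldot (R : realFieldType) (k : nat) (u v : 'cV[R]_k) : R :=
  (u^T *m v) 0 0.

Lemma coldotE (R : realFieldType) (k : nat) (u v : 'cV[R]_k) :
  coldot u v = \sum_(i < k) u i 0 * v i 0.
Proof. by rewrite /coldot mxE; apply: eq_bigr => i _; rewrite mxE. Qed.

Lemma coldotDr (R : realFieldType) (k : nat) (u v w : 'cV[R]_k) :
  coldot u (v + w) = coldot u v + coldot u w.
Proof. by rewrite /coldot mulmxDr mxE. Qed.

Lemma coldotZr (R : realFieldType) (k : nat) (a : R) (u v : 'cV[R]_k) :
  coldot u (a *: v) = a * coldot u v.
Proof. by rewrite /coldot -scalemxAr mxE. Qed.

Lemma coldotC (R : realFieldType) (k : nat) (u v : 'cV[R]_k) :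
  coldot u v = coldot v u.
Proof. by rewrite !coldotE; apply: eq_bigr => i _; rewrite mulrC. Qed.

Lemma coldot_ge0 (R : realFieldType) (k : nat) (u : 'cV[R]_k) : 0 <= coldot u u.
Proof. by rewrite coldotE sumr_ge0// => i _; rewrite -expr2 sqr_ge0. Qed.

Lemma coldot_eq0 (R : realFieldType) (k : nat) (u : 'cV[R]_k) :
  (coldot u u == 0) = (u == 0).
Proof.
apply/idP/eqP => [|->]; last by rewrite /coldot mulmx0 mxE eqxx.
rewrite coldotE psumr_eq0 => [/allP u0|i _]; last by rewrite -expr2 sqr_ge0.
apply/matrixP => i j; rewrite ord1 mxE; apply/eqP.
by have := u0 i (mem_index_enum _); rewrite mulf_eq0 orbb.
Qed.

Lemma coldot_mul (R : realFieldType) (k l : nat) (B : 'M[R]_(k, l))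
    (u : 'cV[R]_k) (v : 'cV[R]_l) : coldot u (B *m v) = coldot (B^T *m u) v.
Proof. by rewrite /coldot trmx_mul trmxK mulmxA. Qed.

Lemma l2norm_sqr (R : realType) (k : nat) (u : 'cV[R]_k) :
  l2norm u ^+ 2 = coldot u u.
Proof.
by rewrite sqr_sqrtr ?sumr_ge0// => [|i _]; rewrite ?sqr_ge0// coldotE.
Qed.

Lemma l2norm_coldot (R : realType) (k : nat) (u : 'cV[R]_k) :
  l2norm u = Num.sqrt (coldot u u).
Proof. by rewrite /l2norm coldotE. Qed.

Lemma l2norm_ge0 (R : realType) (k : nat) (u : 'cV[R]_k) : 0 <= l2norm u.
Proof. exact: sqrtr_ge0. Qed.

Lemma l2norm_eq0 (R : realType) (k : nat) (u : 'cV[R]_k) :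
  (l2norm u == 0) = (u == 0).
Proof. by rewrite l2norm_coldot sqrtr_eq0 -coldot_eq0 eq_le coldot_ge0 andbT. Qed.

Lemma l2normZ (R : realType) (k : nat) (a : R) (u : 'cV[R]_k) :
  0 <= a -> l2norm (a *: u) = a * l2norm u.
Proof.
move=> a0; rewrite !l2norm_coldot coldotZr coldotC coldotZr mulrA -expr2.
by rewrite sqrtrM ?sqr_ge0// sqrtr_sqr ger0_norm.
Qed.

Lemma unitmx_ker0 (F : fieldType) (k : nat) (B : 'M[F]_k) :
  (forall z : 'cV[F]_k, B *m z = 0 -> z = 0) -> B \in unitmx.
Proof.
move=> B0; rewrite -unitmx_tr -row_free_unit -kermx_eq0.
apply/rowV0P => v /sub_kermxP vB; rewrite -[v]trmxK (B0 v^T) ?trmx0//.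
by rewrite -[B]trmxK -trmx_mul vB trmx0.
Qed.

(** With [v = S x], the quadratic form at [x + s v] is [2 s |v|^2 + s^2 v^T S v]; it would be
    negative for small negative [s] unless [v = 0]. *)
Lemma psd_ker (R : realType) (k : nat) (S : 'M[R]_k) (x : 'cV[R]_k) :
  psd S -> coldot x (S *m x) = 0 -> S *m x = 0.
Proof.
move=> [ST S0] xS; apply/eqP; rewrite -coldot_eq0.
set v := S *m x; have S0v z : 0 <= coldot z (S *m z).
  by have := S0 z; rewrite /coldot mulmxA.
have vv0 := coldot_ge0 v; have vSv0 := S0v v.
have q (s : R) : 0 <= 2 * s * coldot v v + s ^+ 2 * coldot v (S *m v).
  have := S0v (x + s *: v).
  rewrite mulmxDr -scalemxAr -/v coldotDr coldotZr !(coldotC (x + _)).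
  rewrite !coldotDr !coldotZr (coldotC v x) xS (coldotC (S *m v) x).
  rewrite (coldot_mul S x v) ST -/v (coldotC (S *m v) v).
  by move=> h; apply: le_trans h _; lra.
case: (eqVneq (coldot v v) 0) => // vv.
have {vv} vv : 0 < coldot v v by rewrite lt_def vv.
(* With [a = |v|^2] and [c = v^T S v], the choice [s = - a / (a + c)] has a positive denominator
   even for [c = 0]. *)
have := q (- (coldot v v) / (coldot v v + coldot v (S *m v))).
set a := coldot v v in vv0 vv *; set c := coldot v (S *m v) in vSv0 *.
rewrite (_ : _ + _ = - (a ^+ 2 * (2 * a + c) / (a + c) ^+ 2)).
  rewrite oppr_ge0 leNgt divr_gt0 ?mulr_gt0 ?exprn_gt0//; lra.
by field; rewrite gt_eqF//; lra.
Qed.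

(** Common shape of [znnM] and of the averaged Jacobian: [a] and [b] are the diagonals in the places
    of [Pi1] and [Pi2]. *)
Definition kktJ (R : realType) (n m p : nat) (H : 'M[R]_n) (A : 'M[R]_(m, n))
    (C : 'M[R]_(p, n)) (a b : 'cV[R]_p) : 'M[R]_(n + (m + p)) :=
  block_mx H (row_mx A^T C^T)
    (col_mx A ((diag_mx a^T - 1%:M) *m C))
    (block_mx 0 0 0 (1%:M - diag_mx b^T)).

Lemma kktJ_mul (R : realType) (n m p : nat) (H : 'M[R]_n) (A : 'M[R]_(m, n))
    (C : 'M[R]_(p, n)) (a b : 'cV[R]_p)
    (x : 'cV[R]_n) (phi : 'cV[R]_m) (psi : 'cV[R]_p) :
  kktJ H A C a b *m col_mx x (col_mx phi psi) =
  col_mx (H *m x + (A^T *m phi + C^T *m psi))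
    (col_mx (A *m x) ((diag_mx a^T - 1%:M) *m C *m x +
                      (1%:M - diag_mx b^T) *m psi)).
Proof.
rewrite /kktJ mul_block_col mul_row_col mul_col_mx mul_block_col !mul0mx.
by rewrite !add0r add_col_mx addr0.
Qed.

(** For a kernel vector, pairing the first block with [x] and using [A x = 0] gives
    [x^T H x + (C x)^T psi = 0]. The last block makes [psi] and [C x] agree in sign entrywise, so
    both terms are nonnegative and vanish. Then [H x = 0], [C x = 0], hence [x = 0] and [psi = 0];
    the row rank of [A] gives [phi = 0]. *)
Lemma kktJ_unit (R : realType) (n m p : nat) (H : 'M[R]_n) (A : 'M[R]_(m, n))
    (C : 'M[R]_(p, n)) (a b : 'cV[R]_p) :
  psd H -> row_free A ->
  (forall x : 'cV[R]_n, H *m x = 0 -> A *m x = 0 -> C *m x = 0 -> x = 0) ->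
  (forall i, a i 0 < 1) -> (forall i, b i 0 < 1) ->
  kktJ H A C a b \in unitmx.
Proof.
move=> psdH freeA ker0 a1 b1; apply: unitmx_ker0 => z.
rewrite -[z]vsubmxK -[dsubmx z]vsubmxK.
set x := usubmx z; set phi := usubmx _; set psi := dsubmx (dsubmx z).
rewrite kktJ_mul -[0]vsubmxK -[dsubmx 0]vsubmxK.
move=> /eq_col_mx[e1 /eq_col_mx[e2 e3]].
rewrite !linear0 in e1 e2 e3.
have cp i : (1 - b i 0) * psi i 0 = (1 - a i 0) * (C *m x) i 0.
  move/matrixP : e3 => /(_ i 0).
  rewrite -mulmxA !mulmxBl !mul1mx !mul_diag_mx !mxE => e; lra.
have cp0 i : 0 <= (C *m x) i 0 * psi i 0.
  have -> : psi i 0 = (1 - a i 0) / (1 - b i 0) * (C *m x) i 0.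
    rewrite mulrAC -cp; field; by rewrite subr_eq0 gt_eqF.
  rewrite mulrCA -expr2 mulr_ge0 ?sqr_ge0// divr_ge0// subr_ge0 ltW//.
have e : coldot x (H *m x) + coldot (C *m x) psi = 0.
  have := congr1 (coldot x) e1.
  rewrite !coldotDr [coldot x (A^T *m _)]coldot_mul.
  rewrite [coldot x (C^T *m _)]coldot_mul.
  rewrite !trmxK e2 /coldot trmx0 mul0mx mulmx0 !mxE add0r; exact.
have Hx0 : 0 <= coldot x (H *m x) by rewrite /coldot mulmxA; exact: psdH.2.
have Cx0 : 0 <= coldot (C *m x) psi by rewrite coldotE sumr_ge0.
have Hx : H *m x = 0 by apply: psd_ker => //; lra.
have Cxi i : (C *m x) i 0 * psi i 0 = 0.
  have : coldot (C *m x) psi == 0 by apply/eqP; lra.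
  rewrite coldotE psumr_eq0// => /allP /(_ i (mem_index_enum _)) /eqP; exact.
have Cx : C *m x = 0.
  apply/matrixP => i j; rewrite ord1 [RHS]mxE; apply/eqP.
  have /eqP := Cxi i; rewrite mulf_eq0 => /orP[//|/eqP p0].
  have /esym/eqP := cp i; rewrite p0 mulr0 mulf_eq0 subr_eq0 gt_eqF//=.
have x0 : x = 0 by exact: ker0.
have psi0 : psi = 0.
  apply/matrixP => i j; rewrite ord1 [RHS]mxE; apply/eqP.
  have Cxi0 : (C *m x) i 0 = 0 by rewrite Cx mxE.
  have /eqP := cp i; rewrite Cxi0 mulr0 mulf_eq0 subr_eq0 gt_eqF//=.
have phi0 : phi = 0.
  move: e1; rewrite Hx psi0 mulmx0 addr0 add0r => /(congr1 trmx).
  rewrite trmx_mul trmxK trmx0 => /eqP; rewrite mulmx_free_eq0//.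
  by move=> /eqP/(congr1 trmx); rewrite trmxK trmx0.
by rewrite x0 phi0 psi0 !linear0.
Qed.

(** Moving the optimum along [z] keeps it feasible and changes the cost linearly. Optimality against
    the steps [1] and [-1] makes the slope 0, so the moved point is optimal too and equals the
    optimum. *)
Lemma qp_unique_ker (R : realType) (n m p : nat) (Q : tvqp R n m p) (t : R)
    (z : 'cV[R]_n) :
  psd (qpH Q t) -> (exists! x : 'cV[R]_n, qp_optimal Q t x) ->
  qpH Q t *m z = 0 -> qpA Q t *m z = 0 -> qpC Q t *m z = 0 -> z = 0.
Proof.
move=> [HT _] [x [[[xA xC] xmin] xuniq]] Hz Az Cz.
have zH : z^T *m qpH Q t = 0 by rewrite -HT -trmx_mul Hz trmx0.
have feas (s : R) : qp_feasible Q t (x + s *: z).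
  split=> [|i]; rewrite mulmxDr -scalemxAr.
    by rewrite Az scaler0 addr0.
  by rewrite Cz scaler0 addr0.
have cost (s : R) :
    qp_cost Q t (x + s *: z) = qp_cost Q t x + s * ((qprho Q t)^T *m z) 0 0.
  rewrite /qp_cost -mulmxA mulmxDr -scalemxAr Hz scaler0 addr0.
  rewrite linearD/= linearZ/= mulmxDl -scalemxAl !mulmxA zH mul0mx scaler0 addr0.
  by rewrite mulmxDr -scalemxAr !mxE addrA.
have rz : ((qprho Q t)^T *m z) 0 0 = 0.
  have := xmin _ (feas 1); have := xmin _ (feas (- 1)); rewrite !cost; lra.
have /xuniq : qp_optimal Q t (x + 1 *: z).
  split=> // x' /xmin; rewrite cost rz mulr0 addr0; exact.
by rewrite scale1r -[X in X = _]addr0 => /addrI.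
Qed.

Lemma ediv_addE (R : realType) (p : nat) (u v a b : 'cV[R]_p) (i : 'I_p) :
  ediv (u + v) (a + b) i 0 = (u i 0 + v i 0) / (a i 0 + b i 0).
Proof. by rewrite /ediv !mxE. Qed.

(** A difference of square roots is the difference of squares over the sum of the roots:
    [r - r' = (r^2 - r'^2) / (r + r')]. Factoring the squares of [s] and [f] yields the averaged
    coefficients; [tau] has cancelled in the hypothesis. *)
Lemma fb_mean_value (R : realType) (p : nat) (s s' f f' r r' w : 'cV[R]_p) :
  w = s' - s -> (forall i, 0 < r i 0 + r' i 0) ->
  (forall i, r i 0 ^+ 2 - r' i 0 ^+ 2 =
     s i 0 ^+ 2 - s' i 0 ^+ 2 + (f i 0 ^+ 2 - f' i 0 ^+ 2)) ->
  s + f - r - (s' + f' - r') =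
  (diag_mx (ediv (s + s') (r + r'))^T - 1%:M) *m w +
  (1%:M - diag_mx (ediv (f + f') (r + r'))^T) *m (f - f').
Proof.
move=> -> rr0 rE; apply/matrixP => i j; rewrite ord1.
rewrite !mulmxBl !mul1mx !mul_diag_mx /ediv !mxE.
have r0 := rr0 i; have e := rE i.
apply: (mulIf (lt0r_neq0 r0)).
rewrite [RHS](_ : _ = (s i 0 - s' i 0 + (f i 0 - f' i 0)) * (r i 0 + r' i 0) -
   (s i 0 ^+ 2 - s' i 0 ^+ 2 + (f i 0 ^+ 2 - f' i 0 ^+ 2))).
  by rewrite -e; ring.
by field; rewrite gt_eqF.
Qed.

(** * The residual map, its exact mean value identity and the invertibility of the averaged
    Jacobian *)

Section Kkt.
Context (R : realType) (n m p : nat) (Q : tvqp R n m p) (tau : 'cV[R]_p).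
Implicit Types (y : 'cV[R]_(n + (m + p))) (t : R).

Lemma kktfE y t : kktf Q tau y t =
  col_mx (qpH Q t *m primal y + ((qpA Q t)^T *m eq_mult y +
            (qpC Q t)^T *m ineq_mult y) + qprho Q t)
    (col_mx (qpA Q t *m primal y - qpb Q t)
       (slack Q y t + ineq_mult y - fb_root Q tau y t)).
Proof.
rewrite /kktf /kktP /kktq -{1}[y]vsubmxK -{1}[dsubmx y]vsubmxK.
rewrite -/(primal y) -/(eq_mult y) -/(ineq_mult y).
rewrite mul_block_col mul_row_col mul_col_mx mul_block_col !mul0mx.
rewrite !add0r mul1mx !add_col_mx addr0.
congr (col_mx _ (col_mx _ _)).
by rewrite /slack mulNmx addrA; congr (_ - _); rewrite addrC addrA.
Qed.

Lemma znnME y t : znnM Q tau y t = kktJ (qpH Q t) (qpA Q t) (qpC Q t)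
  (ediv (slack Q y t) (fb_root Q tau y t))
  (ediv (ineq_mult y) (fb_root Q tau y t)).
Proof. by []. Qed.

Lemma fb_rootE y t i : fb_root Q tau y t i 0 =
  Num.sqrt (slack Q y t i 0 ^+ 2 + ineq_mult y i 0 ^+ 2 + tau i 0).
Proof. by rewrite /fb_root /esqrt /emul !mxE !expr2. Qed.

Hypothesis tau_gt0 : forall i, 0 < tau i 0.

Lemma fb_radicand_gt0 y t i :
  0 < slack Q y t i 0 ^+ 2 + ineq_mult y i 0 ^+ 2 + tau i 0.
Proof. by rewrite ltr_wpDl// addr_ge0// sqr_ge0. Qed.

Lemma fb_root_gt0 y t i : 0 < fb_root Q tau y t i 0.
Proof. by rewrite fb_rootE sqrtr_gt0 fb_radicand_gt0. Qed.

Lemma fb_root_sqr y t i : fb_root Q tau y t i 0 ^+ 2 =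
  slack Q y t i 0 ^+ 2 + ineq_mult y i 0 ^+ 2 + tau i 0.
Proof. by rewrite fb_rootE sqr_sqrtr// ltW// fb_radicand_gt0. Qed.

(** Strictness comes from [tau]; it keeps the averaged entries of [Pi1] below 1. *)
Lemma slack_lt_fb_root y t i : `|slack Q y t i 0| < fb_root Q tau y t i 0.
Proof.
rewrite fb_rootE -sqrtr_sqr ltr_sqrt ?fb_radicand_gt0//.
by rewrite -addrA ltrDl ltr_wpDl// sqr_ge0.
Qed.

Lemma ineq_mult_lt_fb_root y t i :
  `|ineq_mult y i 0| < fb_root Q tau y t i 0.
Proof.
rewrite fb_rootE -sqrtr_sqr ltr_sqrt ?fb_radicand_gt0//.
by rewrite addrAC ltrDr ltr_wpDl// sqr_ge0.
Qed.

(* The entries of [Pi1] and [Pi2] averaged over two states, so that the mean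
   value identity [kktf_sub] is exact. *)
Definition mean_jacobian y y' t : 'M[R]_(n + (m + p)) :=
  kktJ (qpH Q t) (qpA Q t) (qpC Q t)
    (ediv (slack Q y t + slack Q y' t)
          (fb_root Q tau y t + fb_root Q tau y' t))
    (ediv (ineq_mult y + ineq_mult y')
          (fb_root Q tau y t + fb_root Q tau y' t)).

Lemma kktf_sub y y' t :
  kktf Q tau y t - kktf Q tau y' t = mean_jacobian y y' t *m (y - y').
Proof.
have -> : y - y' = col_mx (primal y - primal y')
    (col_mx (eq_mult y - eq_mult y') (ineq_mult y - ineq_mult y')).
  by rewrite -!add_col_mx -!opp_col_mx !vsubmxK.
rewrite kktJ_mul !kktfE opp_col_mx add_col_mx opp_col_mx add_col_mx.
congr (col_mx _ (col_mx _ _)).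
- rewrite !mulmxBr opprD addrACA subrr addr0 opprD addrACA opprD.
  by congr (_ + _); rewrite addrACA.
- by rewrite mulmxBr opprB addrA subrK.
- rewrite -mulmxA; apply: fb_mean_value => [|i|i].
  + by rewrite mulmxBr /slack opprB [RHS]addrC addrA subrK.
  + by rewrite addr_gt0 ?fb_root_gt0.
  + by rewrite !fb_root_sqr; ring.
Qed.

Lemma mean_jacobian_unit y y' t : psd (qpH Q t) -> row_free (qpA Q t) ->
  (exists! x : 'cV[R]_n, qp_optimal Q t x) ->
  mean_jacobian y y' t \in unitmx.
Proof.
move=> Hpsd Afree xuniq; apply: kktJ_unit => // [x|i|i].
- exact: qp_unique_ker.
- rewrite ediv_addE ltr_pdivrMr ?addr_gt0 ?fb_root_gt0// mul1r.
  by rewrite ltrD// (le_lt_trans (ler_norm _)) ?slack_lt_fb_root.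
- rewrite ediv_addE ltr_pdivrMr ?addr_gt0 ?fb_root_gt0// mul1r.
  by rewrite ltrD// (le_lt_trans (ler_norm _)) ?ineq_mult_lt_fb_root.
Qed.

End Kkt.

(** * Implicit solutions *)

Lemma cvg_coldot (R : realFieldType) (T : Type) (F : set_system T)
    (FF : Filter F) (k : nat) (f g : T -> 'cV[R]_k) (a b : 'cV[R]_k) :
  f x @[x --> F] --> a -> g x @[x --> F] --> b ->
  coldot (f x) (g x) @[x --> F] --> coldot a b.
Proof.
by move=> /(cvg_trmx FF) fa gb; exact: ((cvg_mxP _ _ _).1 (cvg_mulmx _ fa gb)).
Qed.

Section ImplicitSolution.
Context (R : realType) (N : nat) (F : 'cV[R]_N -> R -> 'cV[R]_N)
  (J : 'cV[R]_N -> 'cV[R]_N -> R -> 'M[R]_N).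
Hypothesis F_sub : forall y y' t, F y t - F y' t = J y y' t *m (y - y').
Hypothesis J_unit : forall y y' t, J y y' t \in unitmx.
Hypothesis F_cvg : forall y t, F z.1 z.2 @[z --> (y, t)] --> F y t.
Hypothesis J_cvg : forall y t, J z.1 y z.2 @[z --> (y, t)] --> J y y t.

Lemma implicit_inj t : injective (F^~ t).
Proof.
move=> y y' /eqP; rewrite -subr_eq0 F_sub => /eqP.
move=> /(congr1 (mulmx (invmx (J y y' t)))).
by rewrite mulKmx// mulmx0 => /eqP; rewrite subr_eq0 => /eqP.
Qed.

Let cvgF (T : Type) (G : set_system T) (FG : Filter G) (u : T -> 'cV[R]_N)
    (s : T -> R) y t :
  u x @[x --> G] --> y -> s x @[x --> G] --> t ->
  F (u x) (s x) @[x --> G] --> F y t.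
Proof. by move=> uy st; apply: continuous2_cvg uy st; exact: F_cvg. Qed.

Let cvgJ (T : Type) (G : set_system T) (FG : Filter G) (u : T -> 'cV[R]_N)
    (s : T -> R) y t :
  u x @[x --> G] --> y -> s x @[x --> G] --> t ->
  J (u x) y (s x) @[x --> G] --> J y y t.
Proof.
move=> uy st; pose h z r := J z y r.
change (h (u x) (s x) @[x --> G] --> h y t).
by apply: continuous2_cvg uy st; exact: J_cvg.
Qed.

(** Squared Euclidean distance, whose first variation is explicit. Time and target form one variable
    [z], so that both are perturbed together. *)
Let residual (z : R * 'cV[R]_N) y := coldot (F y z.1 - z.2) (F y z.1 - z.2).

Let cvg_residual (T : Type) (G : set_system T) (FG : Filter G)
    (u : T -> 'cV[R]_N) (s : T -> R) (e : T -> 'cV[R]_N) y t e0 :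
  u x @[x --> G] --> y -> s x @[x --> G] --> t -> e x @[x --> G] --> e0 ->
  residual (s x, e x) (u x) @[x --> G] --> residual (t, e0) y.
Proof.
by move=> uy st ee; apply: cvg_coldot; apply: cvgB => //; exact: cvgF.
Qed.

(* Moving against the direction in which the Jacobian reproduces the residual
   vector decreases the squared residual. *)
Lemma residual_interior_min z y0 r c : `|c - y0| < r ->
  (forall y, `|y - y0| <= r -> residual z c <= residual z y) -> F c z.1 = z.2.
Proof.
move=> cr cmin; apply/eqP; rewrite -subr_eq0; set w := F c z.1 - z.2.
apply/negPn/negP => w0.
have ww : 0 < coldot w w by rewrite lt_def coldot_eq0 w0 coldot_ge0.
pose v := invmx (J c c z.1) *m w.
have Jv : J c c z.1 *m v = w by rewrite mulKVmx.
pose Jh (h : R) := J (c + h *: v) c z.1 *m v.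
have ch : c + h *: v @[h --> (0 : R)^'-] --> c.
  rewrite -[X in _ --> X]addr0 -(scale0r v); apply: cvgD; first exact: cvg_cst.
  by apply: cvgZ; [apply: cvg_at_left_filter; exact: cvg_id|exact: cvg_cst].
have cJh : Jh h @[h --> (0 : R)^'-] --> w.
  rewrite -Jv; apply: cvg_mulmx; last exact: cvg_cst.
  exact: (cvgJ _ ch (cvg_cst z.1)).
(* [phi] is the difference quotient of the squared residual along [v]. It tends to [2 |w|^2 > 0], so
   a small negative [h] contradicts minimality. *)
pose phi h := 2 * coldot w (Jh h) + h * coldot (Jh h) (Jh h).
have cphi : phi h @[h --> (0 : R)^'-] --> 2 * coldot w w + 0 * coldot w w.
  apply: cvgD.
    by apply: cvgM; [exact: cvg_cst|exact: (cvg_coldot _ (cvg_cst w) cJh)].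
  apply: cvgM; last exact: (cvg_coldot _ cJh cJh).
  by apply: cvg_at_left_filter; exact: cvg_id.
have cn : `|c + h *: v - y0| @[h --> (0 : R)^'-] --> `|c - y0|.
  by apply: cvg_norm; apply: cvgB => //; exact: cvg_cst.
have resE h : residual z (c + h *: v) = residual z c + h * phi h.
  rewrite /residual.
  have -> : F (c + h *: v) z.1 - z.2 = w + h *: Jh h.
    rewrite -[F (c + _) _](subrK (F c z.1)) F_sub (addrAC c) subrr add0r.
    by rewrite -scalemxAr -addrA addrC.
  rewrite -/w coldotDr coldotZr !(coldotC (w + _)) !(coldotDr _ w) !coldotZr.
  by rewrite (coldotC (Jh h) w) /phi; ring.
suff : \forall h \near (0 : R)^'-, False by move=> /(@filter_ex _ _ _) [].
near=> h.
have h0 : h < 0 by near: h; exact: nbhs_left_lt.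
have ph : 0 < phi h.
  by near: h; apply: (cvgr_gt _ cphi); rewrite mul0r addr0; apply: mulr_gt0.
have nh : `|c + h *: v - y0| < r by near: h; exact: (cvgr_lt _ cn).
have := cmin _ (ltW nh); rewrite resE lerDl leNgt => /negP; apply.
by rewrite nmulr_rlt0.
Unshelve. all: by end_near. Qed.

(** By injectivity the residual at the base point is positive on the sphere [S] and zero at [y0].
    Compactness of [S] preserves the strict inequality for nearby times and targets, so the minimum
    over the ball [B] is interior and is a solution. *)
Lemma implicit_local_solution y0 t0 eta : 0 < eta ->
  \forall z \near (t0, F y0 t0), exists2 y, `|y - y0| < eta & F y z.1 = z.2.
Proof.
move=> eta0; pose r := eta / 2; have r0 : 0 < r by rewrite divr_gt0.
pose B := [set y : 'cV[R]_N | `|y - y0| <= r].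
pose S := [set y : 'cV[R]_N | `|y - y0| = r].
have cB : compact B by exact: compact_mx_ball.
have cS : compact S.
  apply: (subclosed_compact _ cB); last by move=> y; rewrite /S /B /= => ->.
  rewrite (_ : S = (fun y => `|y - y0|) @^-1` [set x | x = r])//.
  apply: closed_comp; last exact: closed_eq.
  move=> y _; apply: (@cvg_norm _ _ _ (nbhs y)).
  exact: (cvgB cvg_id (cvg_cst _)).
have : \forall z \near (t0, F y0 t0),
    S `<=` (fun y => residual z y0 < residual z y).
  apply: ((compact_near_coveringP S).1 cS _ (nbhs (t0, F y0 t0))
    (fun z y => residual z y0 < residual z y) _) => y Sy.
  have d : residual x.2 x.1 - residual x.2 y0
      @[x --> (y, (t0, F y0 t0))] -->
      residual (t0, F y0 t0) y - residual (t0, F y0 t0) y0.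
    have c1 : x.1 @[x --> (y, (t0, F y0 t0))] --> y by exact: cvg_fst.
    have c2 : x.2.1 @[x --> (y, (t0, F y0 t0))] --> t0.
      by apply: (@cvg_comp _ _ _ snd fst); [exact: cvg_snd|exact: cvg_fst].
    have c3 : x.2.2 @[x --> (y, (t0, F y0 t0))] --> F y0 t0.
      by apply: (@cvg_comp _ _ _ snd snd); [exact: cvg_snd|exact: cvg_snd].
    apply: cvgB; first exact: (cvg_residual _ c1 c2 c3).
    exact: (cvg_residual _ (cvg_cst y0) c2 c3).
  have : \forall x \near (y, (t0, F y0 t0)),
      0 < residual x.2 x.1 - residual x.2 y0.
    apply: (cvgr_gt _ d); rewrite /residual/= subrr.
    rewrite {2}/coldot mulmx0 mxE subr0 lt_def coldot_ge0 coldot_eq0 andbT.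
    rewrite subr_eq0; apply/eqP => /implicit_inj yy0.
    by move: Sy; rewrite /S/= yy0 subrr normr0 => /esym/eqP; rewrite gt_eqF.
  by apply: filterS => x; rewrite subr_gt0.
apply: filterS => -[s e]; set z := (s, e) => Sz.
have [||c] := @compact_EVT_min _ R (residual z) B _ cB.
- by exists y0; rewrite /B/= subrr normr0 ltW.
- apply: continuous_subspaceT => y.
  exact: (@cvg_residual _ (nbhs y) _ id (cst s) (cst e) y s e cvg_id
    (cvg_cst s) (cvg_cst e)).
rewrite inE => Bc cmin.
have cmin' y : `|y - y0| <= r -> residual z c <= residual z y.
  by move=> yr; apply: cmin; rewrite inE.
have cr : `|c - y0| < r.
  rewrite lt_neqAle Bc andbT; apply/eqP => /Sz; rewrite ltNge => /negP; apply.
  by apply: cmin'; rewrite subrr normr0 ltW.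
exists c; first by rewrite (lt_trans cr)// ltr_pdivrMr// ltr_pMr// ltr1n.
exact: (residual_interior_min cr cmin').
Qed.

(** Compactness of [[a, b]] makes the neighborhood of admissible targets uniform in time. *)
Lemma implicit_solution_tube (a b : R) :
  (forall t, a <= t <= b -> exists y, F y t = 0) ->
  \forall e \near (0 : 'cV[R]_N), forall t, a <= t <= b -> exists y, F y t = e.
Proof.
move=> sol.
have H : \forall e \near (0 : 'cV[R]_N),
    `[a, b]%classic `<=` (fun t => exists y, F y t = e).
  apply: ((compact_near_coveringP `[a, b]%classic).1 (@segment_compact R a b) _
    (nbhs (0 : 'cV[R]_N)) (fun e t => exists y, F y t = e) _).
  move=> t /=; rewrite in_itv/= => /sol[y0 Fy0].
  have := @implicit_local_solution y0 t 1 ltr01; rewrite Fy0.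
  by apply: filterS => z [y _ Fy]; exists y.
apply: filterS H => e He t tab; apply: He.
by rewrite /= in_itv.
Qed.

(** The local solution near [y t] must be [y s], by injectivity. A general filter also covers the
    one-sided limit at 0. *)
Lemma implicit_solution_cvg (G : set_system R) (FG : Filter G)
    (y : R -> 'cV[R]_N) (e : R -> 'cV[R]_N) (t : R) :
  s @[s --> G] --> t -> e s @[s --> G] --> e t -> F (y t) t = e t ->
  (\forall s \near G, F (y s) s = e s) -> y s @[s --> G] --> y t.
Proof.
move=> Gt Ge Ft Fs; apply/cvgrPdist_lt => eta eta0.
have := @implicit_local_solution (y t) t eta eta0; rewrite Ft => loc.
have : \forall s \near G, exists2 y', `|y' - y t| < eta & F y' s = e s.
  exact: (cvg_pair Gt Ge loc).
apply: filterS2 Fs => s Fs [y' y'eta].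
by rewrite -Fs => /implicit_inj <-; rewrite distrC.
Qed.

(** The mean value identity writes [e - F (y t)] at time [t + h] as an averaged Jacobian applied to
    [y (t + h) - y t]. Dividing by [h], inverting the Jacobian and passing to the limit gives the
    derivative. *)
Lemma implicit_solution_derivable (y : R -> 'cV[R]_N) (e : R -> 'cV[R]_N)
    (t : R) :
  F (y t) t = e t -> (\forall s \near t, F (y s) s = e s) ->
  derivable e t 1 -> derivable (F (y t)) t 1 -> derivable y t 1.
Proof.
move=> Ft Fs de dF.
have ce : e s @[s --> t] --> e t.
  by have /derivable1_diffP d := de; exact: differentiable_continuous.
have cy : y s @[s --> t] --> y t.
  exact: (implicit_solution_cvg _ cvg_id ce Ft Fs).
have dG : derivable (e - F (y t)) t 1 by exact: derivableB.
move/cvg_ex : dG => [/= l Gl].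
apply/cvg_ex; exists (invmx (J (y t) (y t) t) *m l).
have ht : h *: (1 : R) + t @[h --> (0 : R)^'] --> t.
  have : h *: (1 : R) + t @[h --> (0 : R)] --> 0 *: (1 : R) + t.
    by apply: cvgD; [apply: cvgZr_tmp; exact: cvg_id|exact: cvg_cst].
  by rewrite scale0r add0r; exact: cvg_within_filter.
have cJ : J (y (h *: 1 + t)) (y t) (h *: 1 + t) @[h --> (0 : R)^'] -->
    J (y t) (y t) t.
  exact: (cvgJ _ (cvg_comp _ _ ht cy) ht).
apply: cvg_trans _
  (cvg_mulmx _ (cvg_invmx _ (fun h => J_unit _ _ _) (J_unit _ _ _) cJ) Gl).
apply: near_eq_cvg; near=> h.
rewrite -scalemxAr; congr (_ *: _).
have Fh : F (y (h *: 1 + t)) (h *: 1 + t) = e (h *: 1 + t).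
  by near: h; exact: ht Fs.
have -> : (e - F (y t)) (h *: 1 + t) - (e - F (y t)) t =
    J (y (h *: 1 + t)) (y t) (h *: 1 + t) *m (y (h *: 1 + t) - y t).
  by rewrite -F_sub Fh -[(e - _) t]/(e t - F (y t) t) Ft subrr subr0.
by rewrite mulKmx.
Unshelve. all: by end_near. Qed.

End ImplicitSolution.

(** * Limits and derivatives of the Karush-Kuhn-Tucker map *)

Lemma differentiable_on_nonneg_right (R : realType) (V : normedModType R)
    (g : R -> V) : differentiable_on_nonneg g ->
  g x @[x --> (0 : R)^'+] --> g 0.
Proof.
move=> [_ /cvg_ex[/= l gl]].
have : g 0 + h *: (h^-1 *: (g h - g 0)) @[h --> (0 : R)^'+] --> g 0 + 0 *: l.
  apply: cvgD; first exact: cvg_cst.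
  by apply: cvgZ => //; apply: cvg_at_right_filter; exact: cvg_id.
rewrite scale0r addr0; apply: cvg_trans; apply: near_eq_cvg; near=> h.
have h0 : 0 < h by near: h; exact: nbhs_right_gt.
by rewrite scalerA mulfV ?gt_eqF// scale1r addrC subrK.
Unshelve. all: by end_near. Qed.

Lemma cvg_diag_mx (R : realFieldType) (T : Type) (F : set_system T)
    (FF : Filter F) (n : nat) (f : T -> 'rV[R]_n) (a : 'rV[R]_n) :
  f x @[x --> F] --> a -> diag_mx (f x) @[x --> F] --> diag_mx a.
Proof.
move=> /cvg_mxP fa; apply/cvg_mxP => i j; rewrite mxE.
by under eq_cvg do rewrite mxE; apply: cvgMn; exact: fa.
Qed.

Lemma cvg_ediv (R : realType) (T : Type) (F : set_system T)
    (FF : Filter F) (k : nat) (f g : T -> 'cV[R]_k) (a b : 'cV[R]_k) :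
  (forall i, b i 0 != 0) ->
  f x @[x --> F] --> a -> g x @[x --> F] --> b ->
  ediv (f x) (g x) @[x --> F] --> ediv a b.
Proof.
move=> b0 /cvg_mxP fa /cvg_mxP gb; apply/cvg_mxP => i j; rewrite ord1 /ediv mxE.
under eq_cvg do rewrite mxE.
by apply: cvgM; [exact: fa|apply: cvgV => //; exact: gb].
Qed.

Lemma cvg_kktJ (R : realType) (n m p : nat) (T : Type) (F : set_system T)
    (FF : Filter F) (H : T -> 'M[R]_n) (A : T -> 'M[R]_(m, n))
    (C : T -> 'M[R]_(p, n)) (a b : T -> 'cV[R]_p) (H0 : 'M[R]_n)
    (A0 : 'M[R]_(m, n)) (C0 : 'M[R]_(p, n)) (a0 b0 : 'cV[R]_p) :
  H x @[x --> F] --> H0 -> A x @[x --> F] --> A0 -> C x @[x --> F] --> C0 ->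
  a x @[x --> F] --> a0 -> b x @[x --> F] --> b0 ->
  kktJ (H x) (A x) (C x) (a x) (b x) @[x --> F] --> kktJ H0 A0 C0 a0 b0.
Proof.
move=> cH cA cC ca cb; apply: cvg_col_mx; apply: cvg_row_mx => //.
- by apply: cvg_row_mx; exact: cvg_trmx.
- apply: cvg_col_mx => //; apply: cvg_mulmx => //.
  apply: cvgB; last exact: cvg_cst.
  by apply: cvg_diag_mx; exact: cvg_trmx.
- apply: cvg_col_mx; first exact: cvg_cst.
  apply: cvg_row_mx; first exact: cvg_cst.
  apply: cvgB; first exact: cvg_cst.
  by apply: cvg_diag_mx; exact: cvg_trmx.
Qed.

Lemma diag_ediv_mul (R : realType) (p : nat) (u r w : 'cV[R]_p) (i : 'I_p) :
  (diag_mx (ediv u r)^T *m w) i 0 = u i 0 / r i 0 * w i 0.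
Proof. by rewrite mul_diag_mx /ediv !mxE. Qed.

(** Here [d], [u], [v], [w] stand for the derivative of the data [d], [C' x], [C x'] and the
    derivative of the inequality multiplier; [d - (u + v)] is the derivative of the slack, and [D1],
    [D2] are [Pi1], [Pi2]. *)
Lemma kktf_derivative_last_block (R : realType) (p : nat) (D1 D2 : 'M[R]_p)
    (d u v w : 'cV[R]_p) :
  d - (u + v) + w - (D1 *m (d - (u + v)) + D2 *m w) =
  (D1 - 1%:M) *m v + (1%:M - D2) *m w + (D1 - 1%:M) *m u + (1%:M - D1) *m d.
Proof.
rewrite !mulmxBl !mul1mx mulmxBr mulmxDr.
move: (D1 *m d) (D1 *m u) (D1 *m v) (D2 *m w) => a b c e.
by apply/matrixP => i j; rewrite !mxE; ring.
Qed.

Section KktAnalysis.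
Context (R : realType) (n m p : nat) (tau : 'cV[R]_p).
Hypothesis tau_gt0 : forall i, 0 < tau i 0.
Implicit Types (Q : tvqp R n m p) (y : 'cV[R]_(n + (m + p))).

(** The filter and the time map are arbitrary, to serve joint limits in state and time, right limits
    at 0 and constant time alike. *)
Definition data_cvg Q (T : Type) (G : set_system T) (s : T -> R) (t : R) :=
  [/\ qpH Q (s x) @[x --> G] --> qpH Q t,
      qprho Q (s x) @[x --> G] --> qprho Q t,
      qpA Q (s x) @[x --> G] --> qpA Q t &
      qpb Q (s x) @[x --> G] --> qpb Q t] /\
  (qpC Q (s x) @[x --> G] --> qpC Q t /\ qpd Q (s x) @[x --> G] --> qpd Q t).

Section Cvg.
Context Q (T : Type) (G : set_system T) {FG : Filter G} (s : T -> R) (t : R).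
Hypothesis Qt : data_cvg Q G s t.
Context (u : T -> 'cV[R]_(n + (m + p))) (y : 'cV[R]_(n + (m + p))).
Hypothesis uy : u x @[x --> G] --> y.

Lemma cvg_primal : primal (u x) @[x --> G] --> primal y.
Proof. exact: cvg_usubmx. Qed.

Lemma cvg_eq_mult : eq_mult (u x) @[x --> G] --> eq_mult y.
Proof. by apply: cvg_usubmx; exact: cvg_dsubmx. Qed.

Lemma cvg_ineq_mult : ineq_mult (u x) @[x --> G] --> ineq_mult y.
Proof. by apply: cvg_dsubmx; exact: cvg_dsubmx. Qed.

Lemma cvg_slack : slack Q (u x) (s x) @[x --> G] --> slack Q y t.
Proof.
have [_ [QC Qd]] := Qt.
by apply: cvgB => //; apply: cvg_mulmx => //; exact: cvg_primal.
Qed.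

Lemma cvg_fb_root : fb_root Q tau (u x) (s x) @[x --> G] --> fb_root Q tau y t.
Proof.
apply/cvg_mxP => i j; rewrite ord1 fb_rootE !expr2.
under eq_cvg do rewrite fb_rootE !expr2.
apply: (@continuous_cvg _ _ _ _ _ _ (@Num.sqrt R)); first exact: sqrt_continuous.
have ci : slack Q (u x) (s x) i 0 @[x --> G] --> slack Q y t i 0.
  exact: ((cvg_mxP _ _ _).1 cvg_slack).
have cj : ineq_mult (u x) i 0 @[x --> G] --> ineq_mult y i 0.
  exact: ((cvg_mxP _ _ _).1 cvg_ineq_mult).
by apply: cvgD; [apply: cvgD; exact: cvgM|exact: cvg_cst].
Qed.

Lemma cvg_kktf : kktf Q tau (u x) (s x) @[x --> G] --> kktf Q tau y t.
Proof.
have [[QH Qr QA Qb] [QC Qd]] := Qt.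
rewrite kktfE; under eq_cvg do rewrite kktfE.
have c1 := cvg_primal; have c2 := cvg_eq_mult; have c3 := cvg_ineq_mult.
apply: cvg_col_mx.
  apply: cvgD => //; apply: cvgD; first exact: cvg_mulmx.
  by apply: cvgD; (apply: cvg_mulmx => //; exact: cvg_trmx).
apply: cvg_col_mx; first by apply: cvgB => //; exact: cvg_mulmx.
by apply: cvgB; [apply: cvgD => //; exact: cvg_slack|exact: cvg_fb_root].
Qed.

End Cvg.


Lemma cvg_mean_jacobian Q (T : Type) (G : set_system T) (FG : Filter G)
    (s : T -> R) (t : R) (u : T -> 'cV[R]_(n + (m + p))) y :
  data_cvg Q G s t -> u x @[x --> G] --> y ->
  mean_jacobian Q tau (u x) y (s x) @[x --> G] --> mean_jacobian Q tau y y t.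
Proof.
move=> Qt uy; have [[QH _ QA _] [QC _]] := Qt.
have r0 i : (fb_root Q tau y t + fb_root Q tau y t) i 0 != 0.
  by rewrite mxE gt_eqF// addr_gt0 ?fb_root_gt0.
have cr : fb_root Q tau (u x) (s x) + fb_root Q tau y (s x) @[x --> G] -->
    fb_root Q tau y t + fb_root Q tau y t.
  exact: (cvgD (cvg_fb_root Qt uy) (cvg_fb_root Qt (cvg_cst y))).
have cs : slack Q (u x) (s x) + slack Q y (s x) @[x --> G] -->
    slack Q y t + slack Q y t.
  exact: (cvgD (cvg_slack Qt uy) (cvg_slack Qt (cvg_cst y))).
have cm : ineq_mult (u x) + ineq_mult y @[x --> G] -->
    ineq_mult y + ineq_mult y.
  exact: (cvgD (cvg_ineq_mult uy) (cvg_cst (ineq_mult y))).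
apply: (cvg_kktJ FG QH QA QC).
  exact: (cvg_ediv FG r0 cs cr).
exact: (cvg_ediv FG r0 cm cr).
Qed.

Lemma znnM_mul Q y (t : R) z : znnM Q tau y t *m z =
  col_mx (qpH Q t *m primal z + ((qpA Q t)^T *m eq_mult z +
            (qpC Q t)^T *m ineq_mult z))
    (col_mx (qpA Q t *m primal z)
       ((Pi1 Q tau y t - 1%:M) *m (qpC Q t *m primal z) +
        (1%:M - Pi2 Q tau y t) *m ineq_mult z)).
Proof.
rewrite mulmxA /Pi1 /Pi2 -kktJ_mul znnME /primal /eq_mult /ineq_mult.
by rewrite !vsubmxK.
Qed.

Lemma znnN_mul Q y (t : R) z : znnN Q tau y t *m z =
  col_mx (derive1 (qpH Q) t *m primal z +
          ((derive1 (qpA Q) t)^T *m eq_mult z +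
           (derive1 (qpC Q) t)^T *m ineq_mult z))
    (col_mx (derive1 (qpA Q) t *m primal z)
       ((Pi1 Q tau y t - 1%:M) *m (derive1 (qpC Q) t *m primal z))).
Proof.
rewrite /znnN -{1}[z]vsubmxK -{1}[dsubmx z]vsubmxK mulmxA.
by rewrite mul_block_col mul_row_col mul_col_mx mul0mx addr0.
Qed.

Lemma is_derive_kktf Q (y : R -> 'cV[R]_(n + (m + p))) dy (t : R) :
  is_derive t 1 y dy ->
  derivable (qpH Q) t 1 -> derivable (qprho Q) t 1 -> derivable (qpA Q) t 1 ->
  derivable (qpb Q) t 1 -> derivable (qpC Q) t 1 -> derivable (qpd Q) t 1 ->
  is_derive t 1 (fun s => kktf Q tau (y s) s)
    (znnM Q tau (y t) t *m dy + znnN Q tau (y t) t *m y t +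
     znnsigma Q tau (y t) t).
Proof.
move=> yd dH dr dA db dC dd.
have D k l (f : R -> 'M[R]_(k, l)) :
    derivable f t 1 -> is_derive t 1 f (derive1 f t).
  by move=> df; apply: DeriveDef => //; rewrite derive1E.
have {}dH := D _ _ _ dH; have {}dr := D _ _ _ dr; have {}dA := D _ _ _ dA.
have {}db := D _ _ _ db; have {}dC := D _ _ _ dC; have {}dd := D _ _ _ dd.
have dx : is_derive t 1 (fun s => primal (y s)) (primal dy).
  exact: is_derive_usubmx.
have df : is_derive t 1 (fun s => eq_mult (y s)) (eq_mult dy).
  by apply: is_derive_usubmx; exact: is_derive_dsubmx.
have dg : is_derive t 1 (fun s => ineq_mult (y s)) (ineq_mult dy).
  by apply: is_derive_dsubmx; exact: is_derive_dsubmx.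
have dCx := is_derive_mulmx dC dx.
have dsl : is_derive t 1 (fun s => slack Q (y s) s) _ := is_derive_sub dd dCx.
(* Differentiating the square root entrywise divides by [fb_root]; this is the origin of [Pi1] and
   [Pi2]. *)
have droot : is_derive t 1 (fun s => fb_root Q tau (y s) s)
    (Pi1 Q tau (y t) t *m (derive1 (qpd Q) t -
        (derive1 (qpC Q) t *m primal (y t) + qpC Q t *m primal dy)) +
     Pi2 Q tau (y t) t *m ineq_mult dy).
  apply/is_derive_mxP => i j; rewrite ord1.
  have r0 := fb_radicand_gt0 Q tau_gt0 (y t) t i.
  have dsi := (is_derive_mxP _ _ _).1 dsl i 0.
  have dgi := (is_derive_mxP _ _ _).1 dg i 0.
  have drad := is_derive_add (is_derive_add (is_derive_mulr dsi dsi)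
     (is_derive_mulr dgi dgi)) (is_derive_cst (tau i 0) t 1).
  have d := @is_derive1_comp R (@Num.sqrt R) _ t _ _ (is_derive1_sqrt r0) drad.
  rewrite (_ : (fun s => _) = Num.sqrt \o (fun s =>
      slack Q (y s) s i 0 * slack Q (y s) s i 0 +
      ineq_mult (y s) i 0 * ineq_mult (y s) i 0 + tau i 0)); last first.
    by apply/funext => s; rewrite fb_rootE /= !expr2.
  apply: (is_derive_eq d).
  have r0' := fb_root_gt0 Q tau_gt0 (y t) t i.
  rewrite [RHS]mxE /Pi1 /Pi2 !diag_ediv_mul /= -fb_rootE.
  by field; rewrite gt_eqF.
have d3 := is_derive_sub (is_derive_add dsl dg) droot.
have d2 := is_derive_sub (is_derive_mulmx dA dx) db.
have d1 := is_derive_add (is_derive_add (is_derive_mulmx dH dx)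
  (is_derive_add (is_derive_mulmx (is_derive_trmx dA) df)
     (is_derive_mulmx (is_derive_trmx dC) dg))) dr.
have d := is_derive_col_mx d1 (is_derive_col_mx d2 d3).
rewrite (_ : (fun s => _) = (fun s => col_mx
  (qpH Q s *m primal (y s) + ((qpA Q s)^T *m eq_mult (y s) +
            (qpC Q s)^T *m ineq_mult (y s)) + qprho Q s)
    (col_mx (qpA Q s *m primal (y s) - qpb Q s)
       (slack Q (y s) s + ineq_mult (y s) - fb_root Q tau (y s) s)))); last first.
  by apply/funext => s; rewrite kktfE.
apply: (is_derive_eq d).
rewrite znnM_mul znnN_mul /znnsigma !add_col_mx.
congr (col_mx _ (col_mx _ _)).
- move: (derive1 (qpH Q) t *m _) (qpH Q t *m _) => a b.
  move: ((derive1 (qpA Q) t)^T *m _) ((qpA Q t)^T *m _) => c e.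
  move: ((derive1 (qpC Q) t)^T *m _) ((qpC Q t)^T *m _) => f g.
  by apply/matrixP => i j; rewrite !mxE; ring.
- by congr (_ - _); rewrite addrC.
- exact: kktf_derivative_last_block.
Qed.

End KktAnalysis.

(** * Decay of the residual norm *)

Section SettlingEstimates.
Context (R : realType) (alpha gamma tc tp zeta : R) (V N : R -> R).
Hypotheses (alpha_gt0 : 0 < alpha) (alpha_le1 : alpha <= 1).
Hypotheses (gamma_gt0 : 0 < gamma) (tc_gt0 : 0 < tc).
Hypotheses (tp_lt : tp < tc) (zeta_gt0 : 0 < zeta).
Hypotheses (N_ge0 : forall t, 0 <= N t) (V_sqr : forall t, V t = N t ^+ 2).
Hypothesis V_right : V x @[x --> (0 : R)^'+] --> V 0.

(** The weight is normalized to 1 at [tc]. The equations below concern the square [V], which stays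
    differentiable where the norm [N] vanishes. *)
Let k (t : R) := (tc `^ (alpha - 1))^-1 * t `^ (alpha - 1).

Hypothesis V_before : forall t, 0 < t < tc -> is_derive t 1 V
  (- (2 * k t * (N t ^+ 2 / (tc - t) + gamma * N t ^+ 3 / (tc - t) ^+ 2))).
Hypothesis V_after : forall t, tc <= t -> is_derive t 1 V
  (- (2 * (N t ^+ 2 / (tp - t) +
     (zeta + gamma * t `^ (alpha - 1) * N t ^+ 2 / (tp - t) ^+ 2) * N t))).

Let k_ge0 t : 0 <= k t.
Proof. by rewrite /k mulr_ge0 ?invr_ge0 ?powR_ge0. Qed.

Lemma norm_noninc s t : 0 <= s <= t -> t < tc -> N t <= N s.
Proof.
move=> /andP[s0 st] ttc.
have dV x : s < x <= t -> is_derive x 1 V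
    (- (2 * k x * (N x ^+ 2 / (tc - x) + gamma * N x ^+ 3 / (tc - x) ^+ 2))).
  by move=> /andP[sx xt]; apply: V_before; apply/andP; split; lra.
have Vs : V x @[x --> s^'+] --> V s.
  move: s0; rewrite le_eqVlt => /predU1P[<-//|s0].
  apply: cvg_at_right_filter; apply: is_derive_continuous; apply: V_before.
  by rewrite s0 (le_lt_trans st).
have VV : - V s <= - V t.
  apply: (@is_derive_ge0_le R (fun x => - V x) (fun x => - - (2 * k x *
      (N x ^+ 2 / (tc - x) + gamma * N x ^+ 3 / (tc - x) ^+ 2))) s t st).
  - by apply: cvgN.
  - by move=> x /dV h; apply: is_deriveN.
  - move=> x /andP[sx xt]; rewrite opprK.
    have xc : 0 <= tc - x by lra.
    have Nx := N_ge0 x; have kx := k_ge0 x; have g0 := ltW gamma_gt0.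
    apply: mulr_ge0; first by rewrite mulr_ge0.
    by apply: addr_ge0; apply: divr_ge0; rewrite ?mulr_ge0 ?exprn_ge0.
by move: VV; rewrite lerN2 !V_sqr ler_sqr ?nnegrE.
Qed.

(* On a compact subinterval [V' >= - C t^(alpha-1) V], so that
   [V t * expR (C / alpha * t `^ alpha)] is nondecreasing. *)
Lemma norm_neq0_before s : 0 < V 0 -> 0 <= s < tc -> N s != 0.
Proof.
move=> V0 /andP[s0 stc].
pose k0 := (tc `^ (alpha - 1))^-1.
have k0_ge0 : 0 <= k0 by rewrite invr_ge0 powR_ge0.
have qs : 0 < (tc - s)^-1 by rewrite invr_gt0; lra.
(* By monotonicity of [N], [B] bounds on []0, s]] the factor multiplying [- x^(alpha-1) V] in [V'];
   dividing by [alpha] makes [B x^(alpha-1)] the derivative of [c x^alpha]. *)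
pose B := 2 * k0 * ((tc - s)^-1 + gamma * N 0 * (tc - s)^-1 ^+ 2).
pose c := B / alpha.
pose f x := V x * expR (c * x `^ alpha).
have f0s : f 0 <= f s.
  apply: (@is_derive_ge0_le R f (fun x => x `^ (alpha - 1) * N x ^+ 2 *
    expR (c * x `^ alpha) *
    (B - 2 * k0 * ((tc - x)^-1 + gamma * N x * (tc - x)^-1 ^+ 2)))
    0 s s0).
  - apply: cvgM => //.
    apply: (@continuous_cvg _ _ _ _ _ _ (@expR R)).
      exact: (@continuous_expR R).
    apply: cvgM; first exact: cvg_cst.
    by rewrite powR0 ?gt_eqF//; exact: powR_cvg0.
  - move=> x /andP[x0 xs].
    have xtc : x < tc by lra.
    have dx := V_before (introT andP (conj x0 xtc)).
    have dp := is_derive_mulr (is_derive_cst c x 1) (is_derive1_powR alpha x0).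
    have de := @is_derive1_comp R (@expR R) _ x _ _ (is_derive_expR _) dp.
    have d := is_derive_mulr dx de.
    apply: (is_derive_eq d) => /=.
    rewrite V_sqr /k -/k0 mul0r add0r.
    have -> : B = c * alpha by rewrite /c mulfVK// gt_eqF.
    by field; rewrite subr_eq0 gt_eqF.
  - move=> x /andP[x0 xs].
    have Nx : N x <= N 0 by apply: norm_noninc; rewrite ?lexx ?(ltW x0)//; lra.
    have qx : 0 < (tc - x)^-1 by rewrite invr_gt0; lra.
    have qxs : (tc - x)^-1 <= (tc - s)^-1.
      by rewrite lef_pV2 ?posrE; lra.
    rewrite !mulr_ge0 ?powR_ge0 ?exprn_ge0 ?expR_ge0// subr_ge0.
    have q2 : (tc - x)^-1 ^+ 2 <= (tc - s)^-1 ^+ 2.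
      by rewrite ler_sqr ?nnegrE ?(ltW qx) ?(ltW qs).
    apply: ler_wpM2l; first by rewrite mulr_ge0.
    apply: lerD => //; apply: ler_pM => //.
    + by rewrite mulr_ge0 ?(ltW gamma_gt0).
    + by rewrite exprn_ge0 ?(ltW qx).
    + by rewrite ler_pM2l.
apply: contraTneq f0s => Ns; rewrite -ltNge /f V_sqr Ns expr0n/= mul0r.
by rewrite mulr_gt0 ?expR_gt0.
Qed.

(** Since [k >= 1], the quotient [V t / (tc - t)^2] is nonincreasing on [[tc / 2, tc[]. So [V] tends
    to 0 at [tc] from the left, and it is continuous there because [V_after] includes [tc]. *)
Lemma norm_eq0_at : N tc = 0.
Proof.
pose s := tc / 2; have s0 : 0 < s by rewrite divr_gt0.
have stc : s < tc by rewrite /s; move: tc_gt0; lra.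
pose M := N s ^+ 2 / (tc - s) ^+ 2.
have bound t : s <= t < tc -> V t <= M * (tc - t) ^+ 2.
  move=> /andP[st ttc].
  have tct : 0 < tc - t by lra.
  pose f x := - (V x * (tc - x)^-1 ^+ 2).
  pose df x := 2 * (tc - x)^-1 ^+ 2 * ((k x - 1) * N x ^+ 2 / (tc - x) +
    k x * gamma * N x ^+ 3 / (tc - x) ^+ 2).
  have dF x : s <= x <= t -> is_derive x 1 f (df x).
    move=> /andP[sx xt].
    have tcx : 0 < tc - x by lra.
    have xI : 0 < x < tc by apply/andP; split; lra.
    have dsub : is_derive x 1 (fun z : R => tc - z) (0 - 1).
      exact: is_derive_sub (is_derive_cst _ _ _) (is_derive_id _ _).
    have dinv := @is_deriveV R (fun z => tc - z) x _ _ (lt0r_neq0 tcx) dsub.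
    have d := is_deriveN (is_derive_mulr (V_before xI) (is_derive_mulr dinv dinv)).
    have -> : f = - (fun x => V x * ((tc - x)^-1 * (tc - x)^-1)).
      by apply/funext => z; rewrite /f expr2.
    apply: (is_derive_eq d).
    rewrite /df /GRing.scale/= V_sqr.
    by field; rewrite gt_eqF.
  have : f s <= f t.
    apply: (@is_derive_ge0_le R f df s t st).
    - apply: cvg_at_right_filter; apply: is_derive_continuous; apply: dF.
      by rewrite lexx st.
    - by move=> x /andP[sx xt]; apply: dF; rewrite ltW.
    - move=> x /andP[sx xt].
      have tcx : 0 <= tc - x by lra.
      have k1 : 0 <= k x - 1.
        by rewrite subr_ge0; apply: ge1_time_weight => //; apply/andP; split; lra.
      have Nx := N_ge0 x; have kx := k_ge0 x; have g0 := ltW gamma_gt0.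
      apply: mulr_ge0; first by rewrite mulr_ge0 ?exprn_ge0 ?invr_ge0.
      apply: addr_ge0; apply: divr_ge0; rewrite ?exprn_ge0//.
        by apply: mulr_ge0 => //; exact: exprn_ge0.
      by apply: mulr_ge0; [exact: mulr_ge0|exact: exprn_ge0].
  rewrite /f lerN2 => h.
  have -> : V t = (V t * (tc - t)^-1 ^+ 2) * (tc - t) ^+ 2.
    by field; rewrite gt_eqF.
  apply: ler_wpM2r; first exact: sqr_ge0.
  by apply: le_trans h _; rewrite /M V_sqr exprVn.
apply/eqP/negPn/negP => N0.
have Vtc : 0 < V tc - M * (tc - tc) ^+ 2.
  by rewrite subrr expr0n/= mulr0 subr0 V_sqr exprn_gt0// lt_def N0 N_ge0.
have cg : V x - M * (tc - x) ^+ 2 @[x --> tc] --> V tc - M * (tc - tc) ^+ 2.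
  apply: cvgB; first exact: (is_derive_continuous (V_after (lexx tc))).
  apply: cvgM; first exact: cvg_cst.
  have c : tc - x @[x --> tc] --> tc - tc.
    by apply: cvgB; [exact: cvg_cst|exact: cvg_id].
  by under eq_cvg do rewrite expr2; rewrite expr2; exact: cvgM.
have H := cvg_at_left_filter cg.
suff : \forall x \near tc^'-, False by move=> /(@filter_ex _ _ _) [].
near=> x.
have xtc : x < tc by near: x; exact: nbhs_left_lt.
have sx : s <= x by apply/ltW; near: x; exact: nbhs_left_gt.
have : 0 < V x - M * (tc - x) ^+ 2 by near: x; exact: (cvgr_gt _ H).
by apply/negP; rewrite -leNgt subr_le0 bound// sx.
Unshelve. all: by end_near. Qed.

(** As [tp < tc <= t], the term in [1 / (tp - t)] pushes [V] up, but at a rate of at most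
    [2 / (tc - tp)]; the other terms push it down. Hence [V t * expR (- 2 t / (tc - tp))] is
    nonincreasing from its value 0 at [tc]. *)
Lemma norm_eq0_after t : tc <= t -> N t = 0.
Proof.
move=> tct; pose de := tc - tp; have de0 : 0 < de by rewrite /de; move: tp_lt; lra.
pose f x := - (V x * expR (- (2 / de) * x)).
pose df x := 2 * expR (- (2 / de) * x) * (N x ^+ 2 * (de^-1 - (x - tp)^-1) +
     (zeta + gamma * x `^ (alpha - 1) * N x ^+ 2 / (tp - x) ^+ 2) * N x).
have dF x : tc <= x -> is_derive x 1 f (df x).
  move=> tcx.
  have dl := is_derive_mulr (is_derive_cst (- (2 / de)) x 1) (is_derive_id x 1).
  have dE := @is_derive1_comp R (@expR R) _ x _ _ (is_derive_expR _) dl.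
  have d := is_deriveN (is_derive_mulr (V_after tcx) dE).
  apply: (is_derive_eq d).
  rewrite /df /= V_sqr.
  have h1 : x - tp != 0 by rewrite gt_eqF//; move: tp_lt; lra.
  have h2 : tp - x != 0 by rewrite lt_eqF//; move: tp_lt; lra.
  by field; rewrite h1 h2 gt_eqF.
have : f tc <= f t.
  apply: (@is_derive_ge0_le R f df tc t tct).
  - apply: cvg_at_right_filter; apply: is_derive_continuous; exact: dF.
  - by move=> x /andP[sx xt]; apply: dF; rewrite ltW.
  - move=> x /andP[sx xt].
    have Nx := N_ge0 x; have g0 := ltW gamma_gt0; have z0 := ltW zeta_gt0.
    have q : 0 <= de^-1 - (x - tp)^-1.
      by rewrite subr_ge0 lef_pV2 ?posrE /de; move: tp_lt; lra.
    apply: mulr_ge0; first by rewrite mulr_ge0 ?expR_ge0.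
    apply: addr_ge0; first by apply: mulr_ge0 => //; exact: exprn_ge0.
    apply: mulr_ge0 => //; apply: addr_ge0 => //.
    apply: divr_ge0; last exact: sqr_ge0.
    by apply: mulr_ge0; [rewrite mulr_ge0 ?powR_ge0|exact: exprn_ge0].
rewrite /f lerN2 !V_sqr norm_eq0_at expr0n/= mul0r pmulr_lle0 ?expR_gt0//.
by rewrite exprn_even_le0//= => /eqP.
Qed.

End SettlingEstimates.

(** * Trajectories of the network *)

Lemma stabilizer_tp_lt (R : realType) (tc Delta zeta : R) : 0 < tc ->
  stabilizer_tp tc Delta zeta < tc.
Proof.
by move=> tc0; rewrite /stabilizer_tp gtr_pMl// ltrBlDr ltrDl expR_gt0.
Qed.

Lemma stabilizer0 (R : realType) (k : nat) (alpha gamma tc Delta zeta t : R) :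
  stabilizer alpha gamma tc Delta zeta t (0 : 'cV[R]_k) = 0.
Proof. by rewrite /stabilizer; case: ifP => _; rewrite !scaler0 addr0 scaler0. Qed.

Section Stabilizer.
Context (R : realType) (k : nat) (alpha gamma tc Delta zeta : R).
Hypotheses (gamma_gt0 : 0 < gamma) (tc_gt0 : 0 < tc).
Local Notation Phi := (stabilizer alpha gamma tc Delta zeta).
Local Notation tp := (stabilizer_tp tc Delta zeta).
Implicit Types (t : R) (x : 'cV[R]_k).

Lemma stabilizer_before t (r : R) x : t < tc -> 0 < r -> l2norm x = 1 ->
  gamma * t `^ (alpha - 1) *: Phi t (r *: x) =
  ((tc `^ (alpha - 1))^-1 * t `^ (alpha - 1) *
     (r / (tc - t) + gamma * r ^+ 2 / (tc - t) ^+ 2)) *: x.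
Proof.
move=> ttc r0 x1; rewrite /stabilizer ttc l2normZ ?(ltW r0)// x1 mulr1.
have p0 : tc `^ (alpha - 1) != 0 by rewrite gt_eqF// powR_gt0.
rewrite !scalerA -scalerDl !scalerA; congr (_ *: _).
by field; rewrite p0 subr_eq0 !gt_eqF.
Qed.

(** Also valid at [x = 0], where the direction is read as 0; the energy equations thus need no case
    distinction. *)
Lemma coldot_direction x : coldot x ((l2norm x)^-1 *: x) = l2norm x.
Proof.
have [x0|x0] := eqVneq (l2norm x) 0.
  by rewrite x0 invr0 scale0r /coldot mulmx0 mxE.
by rewrite coldotZr -l2norm_sqr expr2 mulKf.
Qed.

Lemma coldot_stabilizer_before t x : t < tc ->
  gamma * t `^ (alpha - 1) * coldot x (Phi t x) =
  (tc `^ (alpha - 1))^-1 * t `^ (alpha - 1) *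
    (l2norm x ^+ 2 / (tc - t) + gamma * l2norm x ^+ 3 / (tc - t) ^+ 2).
Proof.
move=> ttc; rewrite /stabilizer ttc coldotZr coldotDr !coldotZr.
have -> : (l2norm x)^-1 * coldot x x = l2norm x.
  by rewrite -coldotZr coldot_direction.
rewrite -l2norm_sqr.
have p0 : tc `^ (alpha - 1) != 0 by rewrite gt_eqF// powR_gt0.
by field; rewrite p0 subr_eq0 !gt_eqF.
Qed.

Lemma coldot_stabilizer_after t x : tc <= t ->
  gamma * t `^ (alpha - 1) * coldot x (Phi t x) =
  l2norm x ^+ 2 / (tp - t) +
  (zeta + gamma * t `^ (alpha - 1) * l2norm x ^+ 2 / (tp - t) ^+ 2) * l2norm x.
Proof.
move=> tct; have t0 : 0 < t by exact: lt_le_trans tct.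
rewrite /stabilizer ltNge tct/= coldotZr coldotDr !coldotZr.
have -> : (l2norm x)^-1 * coldot x x = l2norm x.
  by rewrite -coldotZr coldot_direction.
rewrite -l2norm_sqr mulVKf ?mulf_neq0 ?gt_eqF ?powR_gt0//.
by congr (_ + _); rewrite mulrC.
Qed.

End Stabilizer.

Lemma is_derive_unique (R : realFieldType) (V : normedModType R) (f : R -> V)
    (t : R) (a b : V) : is_derive t 1 f a -> is_derive t 1 f b -> a = b.
Proof. by move=> [_ <-] [_ <-]. Qed.

Lemma is_derive_coldot (R : realFieldType) (k : nat) (f : R -> 'cV[R]_k)
    (t : R) (df : 'cV[R]_k) : is_derive t 1 f df ->
  is_derive t 1 (fun s => coldot (f s) (f s)) (2 * coldot (f t) df).
Proof.
move=> d; have dd := is_derive_mulmx (is_derive_trmx d) d.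
have := (is_derive_mxP _ _ _).1 dd 0 0 => h.
apply: (is_derive_eq h); rewrite mxE -/(coldot _ _) -/(coldot _ _).
by rewrite coldotC mulr_natl mulr2n.
Qed.

(* The data are only constrained for [t >= 0]; freezing them at [0] for negative
   times makes them continuous on the whole line. *)
Definition clamp_qp (R : realType) (n m p : nat) (Q : tvqp R n m p) :=
  TVQP (fun t => qpH Q (Num.max t 0)) (fun t => qprho Q (Num.max t 0))
       (fun t => qpA Q (Num.max t 0)) (fun t => qpb Q (Num.max t 0))
       (fun t => qpC Q (Num.max t 0)) (fun t => qpd Q (Num.max t 0)).

Lemma data_cvg_comp (R : realType) (n m p : nat) (Q : tvqp R n m p) (t : R)
    (T : Type) (G : set_system T) (FG : Filter G) (s : T -> R) :
  data_cvg Q (nbhs t) id t -> s x @[x --> G] --> t -> data_cvg Q G s t.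
Proof.
move=> [[h1 h2 h3 h4] [h5 h6]] st; split; [split|split].
- exact: (cvg_comp _ _ st h1).
- exact: (cvg_comp _ _ st h2).
- exact: (cvg_comp _ _ st h3).
- exact: (cvg_comp _ _ st h4).
- exact: (cvg_comp _ _ st h5).
- exact: (cvg_comp _ _ st h6).
Qed.

Lemma data_cvg_clamp (R : realType) (n m p : nat) (Q : tvqp R n m p) (t : R) :
  qp_differentiable Q -> data_cvg (clamp_qp Q) (nbhs t) id t.
Proof.
have H (V : normedModType R) (g : R -> V) : differentiable_on_nonneg g ->
    g (Num.max s 0) @[s --> t] --> g (Num.max t 0).
  move=> dg; apply: continuous_max0.
    exact: differentiable_on_nonneg_right.
  move=> t0; apply: differentiable_continuous.
  by apply/derivable1_diffP; exact: dg.1.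
by move=> [[h1 h2 h3 h4] [h5 h6]]; split; [split|split]; exact: H.
Qed.

Lemma data_cvg_right0 (R : realType) (n m p : nat) (Q : tvqp R n m p) :
  qp_differentiable Q -> data_cvg Q (0 : R)^'+ id 0.
Proof.
by move=> [[h1 h2 h3 h4] [h5 h6]]; split; [split|split];
  exact: differentiable_on_nonneg_right.
Qed.

Lemma is_derive_scalel (R : realFieldType) (k : nat) (r : R -> R) (t dr : R)
    (u : 'cV[R]_k) :
  is_derive t 1 r dr -> is_derive t 1 (fun s => r s *: u) (dr *: u).
Proof.
move=> d; apply/is_derive_mxP => i j; rewrite mxE.
under eq_fun do rewrite mxE.
apply: (is_derive_eq (is_derive_mulr d (is_derive_cst (u i j) t 1))).
by rewrite mulr0 addr0.
Qed.

(** * Residual equation, settling and existence of trajectories *)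

Section Network.
Context (R : realType) (n m p : nat) (Q : tvqp R n m p) (tau : 'cV[R]_p).
Context (alpha gamma tc Delta zeta : R).
Hypotheses (alpha_gt0 : 0 < alpha) (alpha_le1 : alpha <= 1).
Hypotheses (gamma_gt0 : 0 < gamma) (tc_gt0 : 0 < tc) (zeta_gt0 : 0 < zeta).
Hypothesis tau_gt0 : forall i, 0 < tau i 0.
Hypothesis psdH : forall t : R, 0 <= t -> psd (qpH Q t).
Hypothesis freeA : forall t : R, 0 <= t -> row_free (qpA Q t).
Hypothesis Qdiff : qp_differentiable Q.
Hypothesis Quniq :
  forall t : R, 0 <= t -> exists! x : 'cV[R]_n, qp_optimal Q t x.
Local Notation f := (kktf Q tau).
Local Notation Phi := (stabilizer alpha gamma tc Delta zeta).
Local Notation traj := (znn_trajectory Q tau alpha gamma Phi).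

Let F := kktf (clamp_qp Q) tau.
Let J := mean_jacobian (clamp_qp Q) tau.

Let F_sub y y' t : F y t - F y' t = J y y' t *m (y - y').
Proof. exact: kktf_sub. Qed.

Let J_unit y y' t : J y y' t \in unitmx.
Proof.
have t0 : 0 <= Num.max t 0 by rewrite le_max lexx orbT.
by apply: mean_jacobian_unit => //=; [exact: psdH|exact: freeA|exact: (Quniq t0)].
Qed.

Let F_cvg y t : F z.1 z.2 @[z --> (y, t)] --> F y t.
Proof.
apply: cvg_kktf; last exact: cvg_fst.
by apply: data_cvg_comp; [exact: data_cvg_clamp|exact: cvg_snd].
Qed.

Let J_cvg y t : J z.1 y z.2 @[z --> (y, t)] --> J y y t.
Proof.
apply: cvg_mean_jacobian => //; last exact: cvg_fst.
by apply: data_cvg_comp; [exact: data_cvg_clamp|exact: cvg_snd].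
Qed.

Let FE y t : 0 <= t -> F y t = f y t.
Proof. by move=> t0; rewrite /F /kktf /kktP /kktq /fb_root /slack/= max_l. Qed.

Lemma kktf_inj t y y' : 0 <= t -> f y t = f y' t -> y = y'.
Proof. by move=> t0; rewrite -!FE//; exact: (implicit_inj F_sub J_unit). Qed.

Lemma derivable_data t : 0 < t ->
  [/\ derivable (qpH Q) t 1, derivable (qprho Q) t 1, derivable (qpA Q) t 1 &
      derivable (qpb Q) t 1] /\ (derivable (qpC Q) t 1 /\ derivable (qpd Q) t 1).
Proof.
by move=> t0; have [[h1 h2 h3 h4] [h5 h6]] := Qdiff; split; split;
  [exact: h1.1|exact: h2.1|exact: h3.1|exact: h4.1|exact: h5.1|exact: h6.1].
Qed.

Lemma is_derive_kktf_data (y : R -> 'cV[R]_(n + (m + p)))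
    (dy : 'cV[R]_(n + (m + p))) (t : R) : 0 < t ->
  is_derive t 1 y dy ->
  is_derive t 1 (fun s => f (y s) s)
    (znnM Q tau (y t) t *m dy + znnN Q tau (y t) t *m y t +
     znnsigma Q tau (y t) t).
Proof.
move=> /derivable_data[[h1 h2 h3 h4] [h5 h6]] yd.
exact: is_derive_kktf.
Qed.

(** The network equation is substituted for [M y'] in the derivative of the residual, where the
    terms in [N] and [sigma] cancel. *)
Lemma trajectory_residual y0 y : traj y0 y ->
  f (y x) x @[x --> (0 : R)^'+] --> f (y 0) 0 /\
  forall t : R, 0 < t -> is_derive t 1 (fun s => f (y s) s)
    (- (gamma * t `^ (alpha - 1) *: Phi t (f (y t) t))).
Proof.
move=> [y0E yc yt]; split.
  by apply: cvg_kktf; [exact: data_cvg_right0|exact: yc].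
move=> t t0; have [dy eq] := yt t t0.
have dy' : is_derive t 1 y (derive1 y t).
  by apply: DeriveDef => //; rewrite derive1E.
apply: (is_derive_eq (is_derive_kktf_data t0 dy')); rewrite eq.
move: (znnN _ _ _ _ *m _) (znnsigma _ _ _ _) (_ *: _) => a b c.
by apply/matrixP => i j; rewrite !mxE; ring.
Qed.

(** Pairing the residual equation with the residual itself gives a closed equation for its squared
    norm, to which the settling estimates apply. *)
Lemma trajectory_settles y0 y : traj y0 y -> f (y 0) 0 != 0 ->
  (forall t, 0 <= t < tc -> f (y t) t != 0) /\
  (forall t, tc <= t -> f (y t) t = 0).
Proof.
move=> tr f0; have [fc fd] := trajectory_residual tr.
pose V t := coldot (f (y t) t) (f (y t) t).
pose N t := l2norm (f (y t) t).
have N0 t : 0 <= N t by exact: l2norm_ge0.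
have VN t : V t = N t ^+ 2 by rewrite /N l2norm_sqr.
have Vc : V x @[x --> (0 : R)^'+] --> V 0 by exact: (cvg_coldot _ fc fc).
have Vd (t : R) : 0 < t -> is_derive t 1 V
   (- (2 * (gamma * t `^ (alpha - 1) * coldot (f (y t) t) (Phi t (f (y t) t))))).
  move=> t0; apply: (is_derive_eq (is_derive_coldot (fd t t0))).
  by rewrite -scaleNr coldotZr mulNr mulrN.
have V1 (t : R) : 0 < t < tc -> is_derive t 1 V
  (- (2 * ((tc `^ (alpha - 1))^-1 * t `^ (alpha - 1)) *
    (N t ^+ 2 / (tc - t) + gamma * N t ^+ 3 / (tc - t) ^+ 2))).
  move=> /andP[t0 ttc]; apply: (is_derive_eq (Vd t t0)).
  by rewrite coldot_stabilizer_before// -(mulrA 2).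
have V2 (t : R) : tc <= t -> is_derive t 1 V
  (- (2 * (N t ^+ 2 / (stabilizer_tp tc Delta zeta - t) +
     (zeta + gamma * t `^ (alpha - 1) * N t ^+ 2 /
        (stabilizer_tp tc Delta zeta - t) ^+ 2) * N t))).
  move=> tct; apply: (is_derive_eq (Vd t _)); first exact: lt_le_trans tct.
  by rewrite coldot_stabilizer_after.
split=> t tI.
  rewrite -l2norm_eq0.
  apply: (norm_neq0_before alpha_gt0 gamma_gt0 N0 VN Vc V1) => //.
  by rewrite lt_def coldot_eq0 f0 coldot_ge0.
apply/eqP; rewrite -l2norm_eq0; apply/eqP.
by apply: (norm_eq0_after alpha_le1 gamma_gt0 tc_gt0 _ zeta_gt0 N0 VN V1 V2) => //;
  exact: stabilizer_tp_lt.
Qed.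

(** The residual is prescribed as [r t] times the unit direction of the initial one. The first
    hypothesis solves for the state along the segment from that residual to 0, the second after
    [tc]. *)
Lemma trajectory_exists y0 :
  (forall (r t : R), 0 <= r <= 1 -> 0 <= t <= tc ->
     exists y, f y t = r *: f y0 0) ->
  (forall t, tc <= t -> exists y, f y t = 0) -> f y0 0 != 0 ->
  exists y, traj y0 y.
Proof.
move=> sol1 sol2 f0.
have N0 : 0 < l2norm (f y0 0) by rewrite lt_def l2norm_eq0 f0 l2norm_ge0.
pose u := (l2norm (f y0 0))^-1 *: f y0 0.
have u1 : l2norm u = 1 by rewrite l2normZ ?invr_ge0 ?(ltW N0)// mulVf ?gt_eqF.
have f0u : f y0 0 = l2norm (f y0 0) *: u.
  by rewrite /u scalerA mulfV ?gt_eqF// scale1r.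
have [r [r0 rc rI rtc rd]] := norm_equation_solution
  (introT andP (conj alpha_gt0 alpha_le1)) gamma_gt0 tc_gt0 N0.
pose e t := r t *: u; pose e' t := e (Num.max t 0).
(* A pointwise choice suffices: injectivity makes the solution unique, and continuity and
   derivability are derived from that and the mean value identity. *)
have /choice[y yE] : forall t, exists y, F y t = e' t.
  move=> t; have t0 : 0 <= Num.max t 0 by rewrite le_max lexx orbT.
  have [ttc|tct] := ltP (Num.max t 0) tc.
    have [] := sol1 (r (Num.max t 0) / l2norm (f y0 0)) (Num.max t 0).
    - have /andP[r1 r2] := rI _ (introT andP (conj t0 ttc)).
      by rewrite divr_ge0 ?(ltW r1) ?(ltW N0)//= ler_pdivrMr// mul1r.
    - by rewrite t0 ltW.
    - by move=> z zE; exists z; rewrite /e' /e /u scalerA -zE.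
  have [z zE] := sol2 _ tct.
  by exists z; rewrite /e' /e (rtc _ tct).1 scale0r -zE.
have fyE t : 0 <= t -> f (y t) t = e t.
  by move=> t0; rewrite -FE// yE /e' max_l.
have er : e x @[x --> (0 : R)^'+] --> e 0.
  by rewrite /e r0; apply: cvgZ => //; exact: cvg_cst.
have ed (t : R) : 0 < t -> is_derive t 1 e
    (- (gamma * t `^ (alpha - 1) *: Phi t (e t))).
  move=> t0; have [ttc|tct] := ltP t tc.
    have tI : 0 < t < tc by rewrite t0.
    have /andP[rt0 _] := rI t (introT andP (conj (ltW t0) ttc)).
    rewrite stabilizer_before// -scaleNr -!mulNr.
    exact: is_derive_scalel (rd t tI).
  (* From [tc] on, [tc] included, [r] and its derivative vanish, and so does [Phi] at 0. *)
  have := is_derive_scalel u (rtc t tct).2.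
  by rewrite /e (rtc t tct).1 !scale0r stabilizer0 scaler0 oppr0.
have e'c (t : R) : 0 <= t -> e' x @[x --> t] --> e' t.
  move=> t0.
  exact: (@continuous_max0 R _ e t er (fun h => is_derive_continuous (ed t h))).
exists y; split.
- have h := fyE 0 (lexx 0); rewrite /e r0 -f0u in h.
  exact: (kktf_inj (lexx 0) h).
- have id0 : s @[s --> (0 : R)^'+] --> (0 : R).
    exact: cvg_at_right_filter cvg_id.
  have e'0 : e' s @[s --> (0 : R)^'+] --> e' 0.
    by apply: cvg_at_right_filter; exact: e'c.
  exact: (@implicit_solution_cvg R _ F J F_sub J_unit F_cvg J_cvg ((0 : R)^'+) _
    y e' 0 id0 e'0 (yE 0) (nearW _ yE)).
- move=> t t0.
  have ne : \forall s \near t, e s = e' s.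
    by near=> s; rewrite /e' max_l// ltW//; near: s; exact: lt_nbhsr.
  have dy : derivable y t 1.
    apply: (@implicit_solution_derivable R _ F J F_sub J_unit F_cvg J_cvg y e' t
      (yE t) (@nearW _ (nbhs t) _ _ yE)).
    + by case: (near_eq_is_derive ne (ed t t0)).
    + have [d _] := is_derive_kktf_data t0 (is_derive_cst (y t) t 1).
      apply: near_eq_derivable d.
      by near=> s; rewrite /= -FE// ltW//; near: s; exact: lt_nbhsr.
  split=> //.
  have dy' : is_derive t 1 y (derive1 y t).
    by apply: DeriveDef => //; rewrite derive1E.
  have ne2 : \forall s \near t, e s = f (y s) s.
    by near=> s; rewrite fyE// ltW//; near: s; exact: lt_nbhsr.
  (* The residual along [y] has two expressions for its derivative, the chain rule and the
     prescribed equation; equating them is the network equation. *)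
  have := is_derive_unique (is_derive_kktf_data t0 dy')
     (near_eq_is_derive ne2 (ed t t0)).
  rewrite -(fyE t (ltW t0)) => eq; rewrite -eq.
  move: (_ *m derive1 y t) (_ *m y t) (znnsigma _ _ _ _) => a b c.
  by apply/matrixP => i j; rewrite !mxE; ring.
Unshelve. all: by end_near. Qed.

(** Uniformity is only claimed on the compact interval [[0, tc]]; later the target residual is 0. *)
Lemma small_residual_solvable :
  (forall t : R, 0 <= t -> exists y, f y t = 0) ->
  exists2 d : R, 0 < d & forall e : 'cV[R]_(n + (m + p)), `|e| < d ->
    forall t, 0 <= t <= tc -> exists y, f y t = e.
Proof.
move=> sol.
have : \forall e \near (0 : 'cV[R]_(n + (m + p))),
    forall t, 0 <= t <= tc -> exists y, F y t = e.
  apply: (implicit_solution_tube F_sub J_unit F_cvg J_cvg) => t /andP[t0 _].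
  by have [y yE] := sol t t0; exists y; rewrite FE.
move=> /nbhs_ballP[d /= d0 H]; exists d => // e ed t tI.
have [|y yE] := H e _ t tI; first by rewrite -ball_normE /= sub0r normrN.
by exists y; rewrite -FE//; case/andP : tI.
Qed.

End Network.

(** * Strictly predefined-time convergence *)

Lemma open_punctured_nonempty (R : realType) (k : nat) (i : 'I_k)
    (O : set 'cV[R]_k) (a : 'cV[R]_k) : open O -> O a ->
  exists b, (O `\ a) b.
Proof.
move=> Oo Oa; pose v : 'cV[R]_k := const_mx 1.
have c : a + h *: v @[h --> (0 : R)^'+] --> a.
  rewrite -[X in _ --> X]addr0 -(scale0r v); apply: cvgD; first exact: cvg_cst.
  by apply: cvgZ; [apply: cvg_at_right_filter; exact: cvg_id|exact: cvg_cst].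
have H : \forall h \near (0 : R)^'+, O (a + h *: v).
  exact: (c O (open_nbhs_nbhs (conj Oo Oa))).
have H0 : \forall h \near (0 : R)^'+, 0 < h by exact: nbhs_right_gt.
have [h [Oh h0]] := filter_ex (filterI H H0).
exists (a + h *: v); split => //= /eqP.
rewrite -subr_eq0 addrAC subrr add0r => /eqP/matrixP/(_ i 0).
by rewrite !mxE mulr1 => /eqP; rewrite gt_eqF.
Qed.

Theorem theorem1 (R : realType) (n m p : nat) (Q : tvqp R n m p)
  (tau : 'cV[R]_p) (alpha gamma tc Delta zeta : R)
  (ystar : R -> 'cV[R]_(n + (m + p)))
  (hn : (0 < n)%N)
  (halpha : 0 < alpha <= 1)
  (hgamma : 0 < gamma)
  (htc : 0 < tc)
  (hDelta : 0 <= Delta)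
  (hzeta : 0 < zeta)
  (hzetaDelta : Delta < zeta)
  (htau : forall i : 'I_p, 0 < tau i 0)
  (hH : forall t : R, 0 <= t -> psd (qpH Q t))
  (hA : forall t : R, 0 <= t -> row_free (qpA Q t))
  (hC : forall t : R, 0 <= t -> row_free (qpC Q t))
  (hdiff : qp_differentiable Q)
  (huniq : forall t : R, 0 <= t -> exists! x : 'cV[R]_n, qp_optimal Q t x)
  (hystar : forall t : R, 0 <= t -> kktf Q tau (ystar t) t = 0) :
  strictly_predefined_time_convergent
    (znn_trajectory Q tau alpha gamma
       (stabilizer alpha gamma tc Delta zeta))
    ystar tc.
Proof.
have /andP[a0 a1] := halpha.
have sol (t : R) : 0 <= t -> exists y, kktf Q tau y t = 0.
  by move=> t0; exists (ystar t); exact: hystar.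
have inj := kktf_inj htau hH hA huniq.
have [d d0 small] := small_residual_solvable tc htau hH hA hdiff huniq sol.
(* A sublevel set of the initial residual: the whole segment from that residual to 0 then consists
   of solvable targets up to time [tc]. *)
pose Omega := [set y | `|kktf Q tau y 0| < d].
have fc : continuous (fun y => kktf Q tau y 0).
  move=> y; have dc : data_cvg Q (nbhs y) (fun=> 0 : R) 0.
    by split; [split|split]; apply: cvg_cst.
  have cy : id z @[z --> y] --> y by exact: cvg_id.
  exact: (cvg_kktf (tau := tau) dc cy).
have Oopen : open Omega.
  rewrite (_ : Omega = (fun y => `|kktf Q tau y 0|) @^-1` [set x | x < d])//.
  apply: open_comp; last exact: open_lt.
  by move=> y _; apply: (@cvg_norm _ _ _ (nbhs y)); exact: fc.
have Ostar : Omega (ystar 0) by rewrite /Omega/= hystar// normr0.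
have f0 y0 : (Omega `\ ystar 0) y0 -> kktf Q tau y0 0 != 0.
  move=> [_ /= y0N]; apply/eqP => h; apply: y0N.
  exact: (inj _ _ _ (lexx (0 : R)) (etrans h (esym (hystar 0 (lexx _))))).
(* A point of the punctured neighborhood keeps the set of settling times nonempty, so its supremum
   is that of the singleton [tc]; [hn] supplies the coordinate index. *)
have [y1 y1D] := open_punctured_nonempty (lshift _ (Ordinal hn)) Oopen Ostar.
exists Omega, (fun=> tc); split.
- by split.
- move=> y0 y0D; have [y0O _] := y0D; split.
    apply: trajectory_exists => //; last exact: f0.
    + move=> r t /andP[r0 r1] tI; apply: small => //.
      rewrite normrZ ger0_norm// (le_lt_trans _ y0O)//.
      by rewrite ler_piMl.
    + by move=> t tct; apply: sol; exact: le_trans (ltW htc) tct.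
  move=> y tr; have [y0E _ _] := tr.
  have fy0 : kktf Q tau (y 0) 0 != 0 by rewrite y0E; exact: f0.
  have [before after] :=
    trajectory_settles a0 a1 hgamma htc hzeta htau hdiff tr fy0.
  split; first exact: ltW.
    move=> t tct; have t0 : 0 <= t by exact: le_trans (ltW htc) tct.
    exact: (inj _ _ _ t0 (etrans (after t tct) (esym (hystar t t0)))).
  (* Agreement with [ystar] from some [s < tc] on would make the residual vanish at [s], before
     [tc]. *)
  move=> s s0 ys; rewrite leNgt; apply/negP => stc.
  have := before s; rewrite s0 stc => /(_ isT) /eqP; apply.
  by rewrite ys// hystar.
- move=> x xD. exists tc; split; first exact: num_real.
  by move=> M /ltW tcM; apply: nearW => z; rewrite /= gtr0_norm.
- by [].
- apply: etrans (sup1 tc); congr (reals.sup _).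
  by apply/seteqP; split=> [_ [? _ <-]//|_ ->]; exists y1.
Qed.
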